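(* Let $L:[0,\infty)\to[1,\infty)$ be a slowly varying function with continuous derivative such that $L(x)\sim L(x/L(x))$ as $x\to\infty$ and $$\sum_{n=1}^\infty\frac 1{nL(n)}<\infty .$$ Then there exist a symmetric Borel probability measure $\mu$ on $\mathbb R$ which is not $\boxplus$-infinitely divisible ($\mu\notin\mathbf D^{\boxplus}$) and a constant $c_4(\mu)>0$ such that $$\Delta(\mu^{n\boxplus},\mathbf D^{\boxplus})\le e^{-c_4(\mu)\sqrt n/L(n)},\qquad n\in\mathbb N .$$
   Context: A positive function $L$ is slowly varying (at infinity) if $L(\lambda x)/L(x)\to 1$ as $x\to\infty$ for every $\lambda>0$; $f\sim g$ means $f/g\to1$. $\boxplus$ denotes the free additive convolution of Borel probability measures on $\mathbb R$, and $\mu^{n\boxplus}=\mu\boxplus\dots\boxplus\mu$ ($n$ times). A probability measure $\mu$ is $\boxplus$-infinitely divisible if for every $n\in\mathbb N$ there is a probability measure $\mu_n$ with $\mu=\mu_n^{n\boxplus}$; $\mathbf D^{\boxplus}$ is the set of all such measures. The Kolmogorov distance is $\Delta(\mu,\nu)=\sup_{x\in\mathbb R}|\mu((-\infty,x))-\nu((-\infty,x))|$, and $\Delta(\mu^{n\boxplus},\mathbf D^{\boxplus}):=\inf_{\nu\in\mathbf D^{\boxplus}}\Delta(\mu^{n\boxplus},\nu)$. *)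

(* Defs.v *)
From HB Require Import structures.
From mathcomp Require Import all_boot all_order all_algebra.
From mathcomp Require Import complex.
From mathcomp Require Import all_classical all_reals all_analysis.
Import Order.TTheory GRing.Theory Num.Theory.
Import numFieldNormedType.Exports.

Set Implicit Arguments.
Unset Strict Implicit.
Unset Printing Implicit Defensive.

Local Open Scope classical_set_scope.
Local Open Scope ring_scope.
Local Open Scope complex_scope.

Section SlowVariation.
Variable R : realType.
Implicit Types f g L : R -> R.

(* f ~ g at +oo *)
Definition asymp_equiv f g : Prop := f x / g x @[x --> +oo] --> (1 : R).

Definition slowly_varying L : Prop :=
  forall lambda : R, 0 < lambda -> asymp_equiv (fun x => L (lambda * x)) L.

(* Functions on [0, +oo[ are represented by total functions whose values at
   negative arguments are irrelevant; the derivative at 0 is one-sided. *)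
Definition continuously_differentiable_ge0 f : Prop :=
  exists2 df : R -> R,
    {within `[0, +oo[, continuous df} &
    forall x : R, 0 <= x ->
      (f y - f x) / (y - x) @[y --> within `[0, +oo[ x^'] --> df x.

End SlowVariation.

Section FreeConvolution.
Variable R : realType.
Local Notation C := R[i].

Definition borel_prob : Type := probability (measurableTypeR R) R.

Implicit Types mu nu rho : borel_prob.

Definition symmetric_prob mu : Prop :=
  forall A : set (measurableTypeR R), measurable A ->
    mu [set x | A (- x)] = mu A.

(* G_mu(z) = \int mu(dt) / (z - t) *)
Definition cauchy_transform mu (z : C) : C :=
  (\int[mu]_t complex.Re ((z - t%:C)^-1))
    +i* (\int[mu]_t complex.Im ((z - t%:C)^-1)).

(* F_mu = 1 / G_mu *)
Definition recip_cauchy mu (z : C) : C := (cauchy_transform mu z)^-1.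

(* Gamma_(alpha, beta) = {x + iy : y > beta, |x| < alpha y} *)
Definition truncated_cone (alpha beta : R) : set C :=
  [set z | beta < complex.Im z /\
           `|complex.Re z| < alpha * complex.Im z].

(* Following Bercovici and Voiculescu, phi is the Voiculescu transform
   F_mu^(-1)(z) - z of mu on D, where F_mu^(-1) is the inverse of the
   restriction of F_mu to a truncated cone on which F_mu is univalent.  Any two
   choices of this cone lead to inverses that coincide near infinity. *)
Definition is_voiculescu_transform mu (D : set C) (phi : C -> C) : Prop :=
  exists alpha beta : R, [/\ 0 < alpha, 0 < beta,
    {in truncated_cone alpha beta &, injective (recip_cauchy mu)} &
    forall z, D z -> truncated_cone alpha beta (z + phi z) /\
                     recip_cauchy mu (z + phi z) = z].

(* rho = mu [+] nu, characterized by phi_rho = phi_mu + phi_nu on a truncated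
   cone; this determines rho. *)
Definition is_free_conv mu nu rho : Prop :=
  exists alpha beta : R, exists phi psi : C -> C,
    [/\ 0 < alpha, 0 < beta,
        is_voiculescu_transform mu (truncated_cone alpha beta) phi,
        is_voiculescu_transform nu (truncated_cone alpha beta) psi &
        is_voiculescu_transform rho (truncated_cone alpha beta)
          (fun z => phi z + psi z)].

(* is_free_power mu n rho : rho = mu [+] ... [+] mu (n times), n >= 1 *)
Inductive is_free_power mu : nat -> borel_prob -> Prop :=
| is_free_power1 : is_free_power mu 1 mu
| is_free_powerS n nu rho :
    is_free_power mu n nu -> is_free_conv nu mu rho ->
    is_free_power mu n.+1 rho.

(* the class D^[+] *)
Definition free_infinitely_divisible : set borel_prob :=
  [set mu | forall n : nat, (0 < n)%N -> exists nu, is_free_power nu n mu].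

Definition kolmogorov_dist mu nu : R :=
  sup [set `|fine (mu [set t | t < x]) - fine (nu [set t | t < x])|
       | x in [set: R]].

Definition kolmogorov_dist_set mu (D : set borel_prob) : R :=
  inf [set kolmogorov_dist mu nu | nu in D].

End FreeConvolution.

(* Main.v *)
(* The hypotheses on [L] only matter through [L >= 1]: one measure achieves the
   geometric rate [(2/3)^n], and [sqrt n / L n <= n].

   Take for [mu] the law with Voiculescu transform [-(5/2)i - 1/z], the free
   deconvolution of a Cauchy law by a semicircle law.  More generally, if
   [g] satisfies [|g| <= T/2] and is 1/4-Lipschitz on [Im z >= 2T], then
   [F(s) + g(F(s)) = s + (5T/2)i] is solved on the closed upper half plane by
   Picard iteration, with [Im F >= 2T], and [1/F] is the Cauchy transform of the
   density [-Im (1/F) / pi].  The case [g = -T/z] needs [T >= 1]: this gives all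
   free powers of [mu], but no free roots.  Its truncation
   [g = -T (1 - (il/(z+il))^N) / z], [l = 2N], has no pole at [0] and is admissible
   for every [T > 0], so its law is infinitely divisible; on [Im z >= 2N] it is
   within [2^-N / 2] of [-N/z], whence a Kolmogorov distance [O(2^-N)].

   If [mu] were the free square of [nu], inverting [F_nu] would give
   [f^2/2 - (x + 5/4) f + 1 = 0] for [f(x) = int x/(x^2+t^2) dnu(t)] and [x] large,
   hence by analyticity for all [x > 0]; at [x = 1/10] the discriminant is
   negative. *)

Require Import Defs.
From HB Require Import structures.
From mathcomp Require Import all_boot all_order all_algebra.
From mathcomp Require Import complex ring lra.
From mathcomp Require Import all_classical all_reals all_analysis.
From mathcomp Require Import measurable_realfun.
Import Order.TTheory GRing.Theory Num.Theory.
Import numFieldNormedType.Exports.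
Set Implicit Arguments.
Unset Strict Implicit.
Unset Printing Implicit Defensive.
Local Open Scope classical_set_scope.
Local Open Scope ring_scope.
Local Open Scope complex_scope.
Import Normc.

(** A Voiculescu transform describes a law only near infinity, so every law in play has to be built.
    The Cauchy component is what makes this elementary: it lifts [F] to height [2T] over the real
    line, so [1/F] is bounded and continuous up to the boundary and its density is explicit. The
    constants fit together: [5T/2 - T/2 = 2T] keeps the iterates in the domain of [g], and the
    Lipschitz constant [1/4] makes the iteration contract. The truncation keeps the transform linear
    in [T], so [T/k] supplies the k-th free root, while [N] stays fixed. The value [l = 2N] serves
    twice: the [N] terms of size at most [1/l] add up to [1/2], and the ratio [il/(z+il)] has
    modulus at most [1/2] once [Im z >= 2N]. The order [N] is taken equal to the number of
    convolution factors, hence the geometric rate. No contour integration occurs. Holomorphy enters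
    through polynomial approximation in the Cayley variable, and, for non-divisibility, through
    Taylor polynomials obtained by iterating the resolvent identity. *)

(** * Modulus and coordinates of complex numbers *)

Section ComplexModulus.
Variable R : rcfType.
Local Notation C := R[i].
Implicit Types z : C.

Lemma normc_ge0 z : 0 <= normc z.
Proof. by case: z => a b; exact: sqrtr_ge0. Qed.

Lemma ler_normcD z1 z2 : normc (z1 + z2) <= normc z1 + normc z2.
Proof. exact: (@le_normcD R z1 z2). Qed.

Lemma normc_opp z : normc (- z) = normc z.
Proof. by case: z => a b /=; rewrite !sqrrN. Qed.

Lemma normc_eq0 z : (normc z == 0) = (z == 0).
Proof.
by apply/eqP/eqP => [/eq0_normc//|->]; rewrite /normc /= expr0n /= addr0 sqrtr0.
Qed.

Lemma normc_gt0 z : (0 < normc z) = (z != 0).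
Proof. by rewrite lt0r normc_ge0 andbT normc_eq0. Qed.

Lemma normc_sqr z : normc z ^+ 2 = complex.Re z ^+ 2 + complex.Im z ^+ 2.
Proof. by case: z => a b /=; rewrite sqr_sqrtr// addr_ge0 ?sqr_ge0. Qed.

Lemma normcJ z : normc (conjc z) = normc z.
Proof. by case: z => a b /=; rewrite sqrrN. Qed.

Lemma normc_real (x : R) : normc x%:C = `|x|.
Proof. by rewrite /= expr0n /= addr0 sqrtr_sqr. Qed.

Lemma normc_imag (x : R) : normc (0 +i* x) = `|x|.
Proof. by rewrite /= expr0n /= add0r sqrtr_sqr. Qed.

Lemma normcX z n : normc (z ^+ n) = normc z ^+ n.
Proof.
elim: n => [|n IH]; first by rewrite !expr0 normc1.
by rewrite !exprS normcM IH.
Qed.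

Lemma normcB z1 z2 : normc (z1 - z2) <= normc z1 + normc z2.
Proof. by rewrite -[normc z2]normc_opp; exact: ler_normcD. Qed.

Lemma normc_distC z1 z2 : normc (z1 - z2) = normc (z2 - z1).
Proof. by rewrite -normc_opp opprB. Qed.

Lemma normc_dist_trans z2 z1 z3 :
  normc (z1 - z3) <= normc (z1 - z2) + normc (z2 - z3).
Proof. by have -> : z1 - z3 = (z1 - z2) + (z2 - z3); [ring|exact: ler_normcD]. Qed.

Lemma lerB_normc z1 z2 : normc z1 - normc z2 <= normc (z1 - z2).
Proof. by rewrite lerBlDr -{1}[z1](subrK z2); exact: ler_normcD. Qed.

Lemma Re_le_normc z : `|complex.Re z| <= normc z.
Proof.
rewrite -(ler_pXn2r (n := 2)) ?nnegrE ?normc_ge0// normc_sqr real_normK ?num_real//.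
by rewrite lerDl sqr_ge0.
Qed.

Lemma Im_le_normc z : `|complex.Im z| <= normc z.
Proof.
rewrite -(ler_pXn2r (n := 2)) ?nnegrE ?normc_ge0// normc_sqr real_normK ?num_real//.
by rewrite lerDr sqr_ge0.
Qed.

Lemma normc_le_ReIm z : normc z <= `|complex.Re z| + `|complex.Im z|.
Proof.
rewrite -(ler_pXn2r (n := 2)) ?nnegrE ?addr_ge0 ?normc_ge0// normc_sqr.
rewrite -[complex.Re z ^+ 2]real_normK ?num_real//.
rewrite -[complex.Im z ^+ 2]real_normK ?num_real//.
by rewrite sqrrD lerD2r lerDl mulrn_wge0// mulr_ge0.
Qed.

Lemma cReD z1 z2 : complex.Re (z1 + z2) = complex.Re z1 + complex.Re z2.
Proof. by case: z1 z2 => ? ? []. Qed.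
Lemma cImD z1 z2 : complex.Im (z1 + z2) = complex.Im z1 + complex.Im z2.
Proof. by case: z1 z2 => ? ? []. Qed.
Lemma cReN z : complex.Re (- z) = - complex.Re z.
Proof. by case: z. Qed.
Lemma cImN z : complex.Im (- z) = - complex.Im z.
Proof. by case: z. Qed.
Lemma cReM z1 z2 : complex.Re (z1 * z2) =
  complex.Re z1 * complex.Re z2 - complex.Im z1 * complex.Im z2.
Proof. by case: z1 z2 => ? ? []. Qed.
Lemma cImM z1 z2 : complex.Im (z1 * z2) =
  complex.Re z1 * complex.Im z2 + complex.Im z1 * complex.Re z2.
Proof. by case: z1 z2 => ? ? [? ?] /=; rewrite [X in _ + X]mulrC. Qed.
Lemma cReV z : complex.Re z^-1 = complex.Re z / normc z ^+ 2.
Proof. by rewrite normc_sqr; case: z. Qed.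
Lemma cImV z : complex.Im z^-1 = - complex.Im z / normc z ^+ 2.
Proof. by rewrite normc_sqr; case: z => a b /=; rewrite mulNr. Qed.

Lemma conjc_D y z : conjc (y + z) = conjc y + conjc z.
Proof. exact: (raddfD (@conjc R)). Qed.

Lemma conjc_N z : conjc (- z) = - conjc z.
Proof. exact: (raddfN (@conjc R)). Qed.

Lemma conjc_sum n (f : 'I_n -> C) :
  conjc (\sum_(j < n) f j) = \sum_(j < n) conjc (f j).
Proof. exact: (raddf_sum (@conjc R)). Qed.

Lemma conjc_M y z : conjc (y * z) = conjc y * conjc z.
Proof. exact: (rmorphM (@conjc R)). Qed.

Lemma conjc_X z n : conjc (z ^+ n) = conjc z ^+ n.
Proof. exact: (rmorphXn (@conjc R)). Qed.

Lemma Im_gt0_neq0 z : 0 < complex.Im z -> z != 0.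
Proof. by apply: contraTneq => ->; rewrite ltxx. Qed.

Lemma complex_eqP z1 z2 : complex.Re z1 = complex.Re z2 ->
  complex.Im z1 = complex.Im z2 -> z1 = z2.
Proof. by case: z1 z2 => ? ? [? ?] /= -> ->. Qed.

End ComplexModulus.

Definition cReImE := (cReD, cImD, cReN, cImN, cReM, cImM).

(** * The disc algebra of the upper half plane *)

Section CayleyAlgebra.
Variable R : realType.
Local Notation C := R[i].
Variable w : C.
Hypothesis w_gt0 : 0 < complex.Im w.
Implicit Types (s z : C) (Phi Psi X : C -> C) (p : {poly C}).

(** The conformal map of the upper half plane onto the unit disc that sends [w] to 0, so that
    evaluating a polynomial at [w] leaves its constant coefficient. *)
Definition cayley s : C := (s - w) / (s - conjc w).

(* Uniform limits of polynomials in the Cayley variable at [w].  Closure under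
   products and limits replaces contour integration: the Poisson formula at [w]
   need only be checked on monomials. *)
Definition disc_algebra Phi : Prop :=
  forall e : R, 0 < e -> exists p : {poly C}, forall s, 0 <= complex.Im s ->
    normc (Phi s - p.[cayley s]) <= e.

Lemma cayley_den_neq0 s : 0 <= complex.Im s -> s - conjc w != 0.
Proof.
move=> s0; apply: Im_gt0_neq0; rewrite cReImE; case: (w) w_gt0 => a b /= b0.
by rewrite opprK ltr_wpDl.
Qed.

Lemma cayley_le1 s : 0 <= complex.Im s -> normc (cayley s) <= 1.
Proof.
move=> s0; rewrite normcM normcV ler_pdivrMr ?normc_gt0 ?cayley_den_neq0//.
rewrite mul1r -(ler_pXn2r (n := 2)) ?nnegrE ?normc_ge0// !normc_sqr.
move: s0 w_gt0; case: (s) => x y; case: (w) => u v /= y0 v0.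
rewrite lerD2l opprK; nra.
Qed.

Lemma normc_horner_bound p : exists2 M : R, 0 <= M &
  forall z, normc z <= 1 -> normc p.[z] <= M.
Proof.
elim/poly_ind: p => [|p c [M M0 pM]].
  by exists 0 => // z _; rewrite horner0 normc0.
exists (M + normc c) => [|z z1]; first by rewrite addr_ge0 ?normc_ge0.
rewrite hornerMXaddC (le_trans (ler_normcD _ _))// lerD2r normcM.
by rewrite -[M]mulr1 ler_pM ?normc_ge0 ?pM.
Qed.

Lemma disc_algebra_bounded Phi : disc_algebra Phi -> exists2 M : R, 0 <= M &
  forall s, 0 <= complex.Im s -> normc (Phi s) <= M.
Proof.
move=> /(_ 1 ltr01)[p pP]; have [M M0 pM] := normc_horner_bound p.
exists (1 + M) => [|s s0]; first by rewrite addr_ge0.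
rewrite -[Phi s](subrK p.[cayley s]) (le_trans (ler_normcD _ _))//.
by rewrite lerD ?pP// pM// cayley_le1.
Qed.

Lemma disc_algebra_lim Phi :
  (forall e : R, 0 < e -> exists2 Psi, disc_algebra Psi &
    forall s, 0 <= complex.Im s -> normc (Phi s - Psi s) <= e) ->
  disc_algebra Phi.
Proof.
move=> H e e0; have e20 : 0 < e / 2 by rewrite divr_gt0.
have [Psi /(_ _ e20)[p pP] PsiP] := H _ e20; exists p => s s0.
rewrite (le_trans (normc_dist_trans (Psi s) _ _))//.
by rewrite [leRHS](splitr e) lerD ?PsiP ?pP.
Qed.

Lemma disc_algebra_ext Phi Psi : disc_algebra Psi ->
  (forall s, 0 <= complex.Im s -> Phi s = Psi s) -> disc_algebra Phi.
Proof.
by move=> PsiA PhiPsi; apply: disc_algebra_lim => e e0; exists Psi => // s s0;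
  rewrite PhiPsi// subrr normc0 ltW.
Qed.

Lemma disc_algebra_poly p : disc_algebra (fun s => p.[cayley s]).
Proof. by move=> e e0; exists p => s s0; rewrite subrr normc0 ltW. Qed.

Lemma disc_algebra_cst c : disc_algebra (fun=> c).
Proof.
by apply: disc_algebra_ext (disc_algebra_poly c%:P) _ => s _; rewrite hornerC.
Qed.

Lemma disc_algebraD Phi Psi : disc_algebra Phi -> disc_algebra Psi ->
  disc_algebra (fun s => Phi s + Psi s).
Proof.
move=> A B e e0; have e20 : 0 < e / 2 by rewrite divr_gt0.
have [p pP] := A _ e20; have [q qP] := B _ e20; exists (p + q) => s s0.
rewrite hornerD opprD addrACA (le_trans (ler_normcD _ _))//.
by rewrite [leRHS](splitr e) lerD ?qP ?pP.
Qed.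

Lemma disc_algebraM Phi Psi : disc_algebra Phi -> disc_algebra Psi ->
  disc_algebra (fun s => Phi s * Psi s).
Proof.
move=> A B; have [M M0 PhiM] := disc_algebra_bounded A.
have [N N0 PsiN] := disc_algebra_bounded B.
have K0 : 0 < M + N + 1 by rewrite ltr_wpDl// addr_ge0.
(* The product error is at most [d * N + M * d + d * d]; [d <= 1] linearizes the last term. *)
move=> e e0; pose d := Num.min 1 (e / 2 / (M + N + 1)).
have d0 : 0 < d by rewrite lt_min ltr01 divr_gt0// divr_gt0.
have d1 : d <= 1 by rewrite ge_min lexx.
have de : d * (M + N + 1) <= e / 2 by rewrite -ler_pdivlMr// ge_min lexx orbT.
have [p pP] := A _ d0; have [q qP] := B _ d0; exists (p * q) => s s0.
rewrite hornerM; set P := p.[_]; set Q := q.[_].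
have -> : Phi s * Psi s - P * Q =
  (Phi s - P) * Psi s + (Phi s * (Psi s - Q) - (Phi s - P) * (Psi s - Q)).
  by ring.
rewrite (le_trans (ler_normcD _ _))// (le_trans (lerD (lexx _) (normcB _ _)))//.
rewrite !normcM; have ad : normc (Phi s - P) <= d := pP _ s0.
have bd : normc (Psi s - Q) <= d := qP _ s0.
have h1 : normc (Phi s - P) * normc (Psi s) <= d * N.
  by rewrite ler_pM ?normc_ge0 ?PsiN.
have h2 : normc (Phi s) * normc (Psi s - Q) <= M * d.
  by rewrite ler_pM ?normc_ge0 ?PhiM.
have h3 : normc (Phi s - P) * normc (Psi s - Q) <= d * 1.
  by rewrite ler_pM ?normc_ge0// (le_trans bd).
lra.
Qed.

Lemma disc_algebraN Phi : disc_algebra Phi -> disc_algebra (fun s => - Phi s).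
Proof.
move=> A; apply: disc_algebra_ext (disc_algebraM (disc_algebra_cst (-1)) A) _.
by move=> s _; rewrite mulN1r.
Qed.

Lemma disc_algebraB Phi Psi : disc_algebra Phi -> disc_algebra Psi ->
  disc_algebra (fun s => Phi s - Psi s).
Proof. by move=> A B; exact: disc_algebraD (disc_algebraN B). Qed.

Lemma disc_algebraX Phi n : disc_algebra Phi -> disc_algebra (fun s => Phi s ^+ n).
Proof.
move=> A; elim: n => [|n IH].
  by apply: disc_algebra_ext (disc_algebra_cst 1) _ => s _; rewrite expr0.
by apply: disc_algebra_ext (disc_algebraM A IH) _ => s _; rewrite exprS.
Qed.

Lemma disc_algebra_sum (F : nat -> C -> C) n : (forall k, disc_algebra (F k)) ->
  disc_algebra (fun s => \sum_(k < n) F k s).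
Proof.
move=> A; elim: n => [|n IH].
  by apply: disc_algebra_ext (disc_algebra_cst 0) _ => s _; rewrite big_ord0.
by apply: disc_algebra_ext (disc_algebraD IH (A n)) _ => s _; rewrite big_ord_recr.
Qed.

Lemma geometric_small (q K e : R) : 0 <= q < 1 -> 0 < e ->
  exists n, q ^+ n * K <= e.
Proof.
move=> /andP[q0 q1] e0.
have /cvgrPdist_le : (fun n => q ^+ n * K) @ \oo --> (0 : R).
  rewrite -(mul0r K); apply: cvgM; last exact: cvg_cst.
  by apply: cvg_expr; rewrite ger0_norm.
move=> /(_ _ e0)[n _ /(_ n)]; rewrite /= leqnn => /(_ isT) H; exists n.
by rewrite (le_trans (ler_norm _))// -normrN -sub0r.
Qed.

(** Neumann series: the tail after [n] terms is [X ^+ n / (1 - X)], at most [q ^+ n / (1 - q)]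
    uniformly in [s]. *)
Lemma disc_algebra_geom X (q : R) : q < 1 -> disc_algebra X ->
  (forall s, 0 <= complex.Im s -> normc (X s) <= q) ->
  disc_algebra (fun s => (1 - X s)^-1).
Proof.
move=> q1 A Xq.
have q0 : 0 <= q by apply: le_trans (normc_ge0 _) (Xq 0 _).
have q1' : 0 < 1 - q by rewrite subr_gt0.
apply: disc_algebra_lim => e e0.
have [n ne] := @geometric_small q (1 - q)^-1 e (introT andP (conj q0 q1)) e0.
exists (fun s => \sum_(k < n) X s ^+ k).
  apply: (@disc_algebra_sum (fun k s => X s ^+ k)) => k.
  exact: disc_algebraX.
move=> s s0; have Xs := Xq _ s0.
have D : 1 - q <= normc (1 - X s).
  by rewrite (le_trans _ (lerB_normc _ _))// normc1 lerD2l lerN2.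
have X1 : 1 - X s != 0 by rewrite -normc_gt0 (lt_le_trans q1').
have -> : (1 - X s)^-1 - \sum_(k < n) X s ^+ k = X s ^+ n / (1 - X s).
  apply: (mulIf X1); rewrite mulrBl mulVf// divfK//.
  have := subrX1 (X s) n; set S := \sum_(i < n) _ => E.
  by have -> : X s ^+ n = X s ^+ n - 1 + 1; [ring|rewrite E; ring].
rewrite normcM normcV normcX (le_trans _ ne)// ler_pM ?invr_ge0 ?normc_ge0//.
- by rewrite exprn_ge0// normc_ge0.
- by rewrite lerXn2r ?nnegrE ?normc_ge0.
- by rewrite lef_pV2 ?posrE// (lt_le_trans q1').
Qed.

(** In the Cayley variable [v] the function is [(1 - v) / (1 - q v)] up to the factor [1 / (w + c)].
    Its pole [1 / q] is the image of [- c], a point of the lower half plane, so [q] has modulus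
    below 1 and the geometric series applies. *)
Lemma disc_algebra_pole (a : R) : 0 < a ->
  disc_algebra (fun s => (s + 0 +i* a)^-1).
Proof.
move=> a0; set c : C := 0 +i* a.
have wc : w + c != 0.
  by apply: Im_gt0_neq0; rewrite cReImE /= addr_gt0.
pose q := (conjc w + c) / (w + c).
have q1 : normc q < 1.
  rewrite normcM normcV ltr_pdivrMr ?normc_gt0// mul1r.
  rewrite -(ltr_pXn2r (n := 2)) ?nnegrE ?normc_ge0// !normc_sqr /c.
  by move: w_gt0; case: (w) => u v /= v0; rewrite ltrD2l; nra.
have A1 : disc_algebra cayley.
  by apply: disc_algebra_ext (disc_algebra_poly 'X) _ => s _; rewrite hornerX.
have A2 : disc_algebra (fun s => (1 - q * cayley s)^-1).
  apply: (disc_algebra_geom q1) => [|s s0].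
    exact: disc_algebraM (disc_algebra_cst _) A1.
  by rewrite normcM ler_piMr ?normc_ge0// cayley_le1.
apply: disc_algebra_ext (disc_algebraM (disc_algebraM (disc_algebra_cst (w + c)^-1)
  (disc_algebraB (disc_algebra_cst 1) A1)) A2) _ => s s0 /=.
have d0 := cayley_den_neq0 s0.
have sc : s + c != 0 by apply: Im_gt0_neq0; rewrite cReImE /= ltr_wpDl.
have ww : w - conjc w != 0.
  apply: Im_gt0_neq0; rewrite cReImE; case: (w) w_gt0 => ? ? /= ?.
  by rewrite opprK addr_gt0.
rewrite /cayley /q; field.
have -> : (w + c) * (s - conjc w) - (conjc w + c) * (s - w) = (w - conjc w) * (s + c) by ring.
by rewrite sc wc d0 mulf_neq0.
Qed.

(** Factor out [1 / (s + ia)]; since [s + ia] has modulus at least [a], what remains is a geometric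
    series of ratio at most [r / a]. *)
Lemma disc_algebra_inv X (a r : R) : 0 < a -> r < a -> disc_algebra X ->
  (forall s, 0 <= complex.Im s -> normc (X s) <= r) ->
  disc_algebra (fun s => (s + 0 +i* a - X s)^-1).
Proof.
move=> a0 ra A Xr; set c : C := 0 +i* a.
have P := disc_algebra_pole a0.
have sc s : 0 <= complex.Im s -> a <= normc (s + c).
  move=> s0; rewrite (le_trans _ (Im_le_normc _))// cReImE /=.
  by rewrite ger0_norm ?addr_ge0 ?lerDr// ltW.
have sc0 s : 0 <= complex.Im s -> s + c != 0.
  by move=> s0; rewrite -normc_gt0 (lt_le_trans a0)// sc.
have XA : disc_algebra (fun s => (1 - X s * (s + c)^-1)^-1).
  apply: (@disc_algebra_geom _ (r / a)); first by rewrite ltr_pdivrMr// mul1r.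
    exact: disc_algebraM.
  move=> s s0; rewrite normcM normcV ler_pM ?invr_ge0 ?normc_ge0 ?Xr//.
  by rewrite lef_pV2 ?posrE ?normc_gt0 ?sc0// sc.
apply: disc_algebra_ext (disc_algebraM P XA) _ => s s0 /=; rewrite -/c.
rewrite -invfM mulrBr mulr1 mulrC divfK ?sc0//.
Qed.

End CayleyAlgebra.

(** * The Poisson formula *)

Section LineIntegrals.
Variable R : realType.
Local Notation C := R[i].
Local Notation Re := (@complex.Re R).
Local Notation Im := (@complex.Im R).
Local Notation mu := (@lebesgue_measure R).
Implicit Types (f H h : R -> R).

Lemma integrable_oneDsqrV :
  mu.-integrable setT (fun t : R => (1 + t ^+ 2)^-1%:E).
Proof.
have m : measurable_fun setT (fun t : R => (1 + t ^+ 2)^-1).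
  by apply: continuous_measurable_fun; exact: continuous_oneDsqrV.
have p0 (t : R) : 0 <= (1 + t ^+ 2)^-1 by rewrite invr_ge0 addr_ge0 ?sqr_ge0.
apply/integrableP; split; first exact/measurable_EFinP.
under eq_integral do rewrite gee0_abs ?lee_fin ?p0//.
rewrite (@ge0_symfun_integralT R (fun t => (1 + t ^+ 2)^-1))//.
- rewrite -set_itvcy; have := @integral0y_oneDsqr R.
  by rewrite /oneDsqr => -> ; rewrite -EFinM ltry.
- exact: continuous_oneDsqrV.
- by move=> t /=; rewrite sqrrN.
Qed.

Lemma integrable_le_oneDsqrV f (K : R) : measurable_fun setT f ->
  (forall t, `|f t| <= K / (1 + t ^+ 2)) -> mu.-integrable setT (EFin \o f).
Proof.
move=> mf fK; have := integrableZl measurableT K integrable_oneDsqrV.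
apply: le_integrable => //; first exact/measurable_EFinP.
move=> t _ /=; rewrite lee_fin (le_trans (fK t))// ler_norm//.
Qed.

(** The fundamental theorem on growing symmetric intervals, passed to the limit by dominated
    convergence with [|f|] as dominating function. *)
Lemma Rintegral_line_FTC f H (d : R) : continuous f ->
  (forall t : R, is_derive t 1 H (f t)) -> mu.-integrable setT (EFin \o f) ->
  (fun n : nat => H n%:R - H (- n%:R)) @ \oo --> d -> \int[mu]_t f t = d.
Proof.
move=> cf dH intf Hd.
pose I (n : nat) : set R := `[- n%:R, n%:R]%classic.
have mI n : measurable (I n) by exact: measurable_itv.
have mf : measurable_fun setT f by exact: continuous_measurable_fun.
(* The index [n.+1] keeps the interval nondegenerate, as the fundamental theorem requires. *)
have Hn n : (\int[mu]_(t in setT) ((EFin \o f) \_ (I n.+1)) t)%E =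
    (H n.+1%:R - H (- n.+1%:R))%:E.
  rewrite -integral_mkcond /I (@continuous_FTC2 _ f H)//.
  - by rewrite gtrN// ltr0n.
  - exact: continuous_subspaceT.
  - have cH (t : R) : {for t, continuous H}.
      by apply/differentiable_continuous/derivable1_diffP; have [] := dH t.
    split; first by move=> t _; have [] := dH t.
      exact/cvg_at_right_filter/cH.
    exact/cvg_at_left_filter/cH.
  - by move=> t _; rewrite derive1E; have [] := dH t.
have cv : (fun n => \int[mu]_(t in setT) ((EFin \o f) \_ (I n.+1)) t)%E @ \oo -->
    (\int[mu]_(t in setT) (f t)%:E)%E.
  apply: (@dominated_cvg _ _ _ mu setT _ _ _ (EFin \o (fun t => `|f t|))) => //.
  - move=> n; apply/(measurable_restrictT _ (mI _)).
    exact/measurable_funTS/measurable_EFinP.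
  - move=> t _; apply: cvg_near_cst; exists (Num.bound `|t|) => // n /= tn.
    rewrite patchE ifT// inE /I/= in_itv/= -ler_norml.
    rewrite (le_trans (ltW (archi_boundP _)))// ler_nat (leq_trans tn)//.
  - by have := integrable_abse intf.
  - by move=> n t _ /=; rewrite patchE; case: ifPn => _ /=; rewrite lee_fin// normr0.
rewrite /Rintegral; suff -> : (\int[mu]_(t in setT) (f t)%:E)%E = d%:E by [].
apply: (cvg_unique _ cv) => //; rewrite (funext Hn).
apply: cvg_EFin; first exact: nearW.
have := Hd; rewrite -(cvg_shiftS (fun n : nat => H n%:R - H (- n%:R))).
by [].
Qed.

Definition ccontinuous (z : R -> C) :=
  continuous (Re \o z) /\ continuous (Im \o z).

Lemma ccontinuous_cst c : ccontinuous (fun=> c).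
Proof. by split=> t; exact: cvg_cst. Qed.

Lemma ccontinuousD (y z : R -> C) : ccontinuous y -> ccontinuous z ->
  ccontinuous (fun t => y t + z t).
Proof.
move=> [yr yi] [zr zi]; split=> t.
  rewrite (_ : Re \o _ = fun t => Re (y t) + Re (z t)); last first.
    by apply/funext => s /=; rewrite cReD.
  by apply: (@cvgD _ R^o); [exact: yr|exact: zr].
rewrite (_ : Im \o _ = fun t => Im (y t) + Im (z t)); last first.
  by apply/funext => s /=; rewrite cImD.
by apply: (@cvgD _ R^o); [exact: yi|exact: zi].
Qed.

Lemma ccontinuousM (y z : R -> C) : ccontinuous y -> ccontinuous z ->
  ccontinuous (fun t => y t * z t).
Proof.
move=> [yr yi] [zr zi]; split=> t.
  rewrite (_ : Re \o _ = fun t => Re (y t) * Re (z t) - Im (y t) * Im (z t)); last first.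
    by apply/funext => s /=; rewrite cReM.
  by apply: (@cvgB _ R^o); apply: cvgM; [exact: yr|exact: zr|exact: yi|exact: zi].
rewrite (_ : Im \o _ = fun t => Re (y t) * Im (z t) + Im (y t) * Re (z t)); last first.
  by apply/funext => s /=; rewrite cImM.
by apply: (@cvgD _ R^o); apply: cvgM; [exact: yr|exact: zi|exact: yi|exact: zr].
Qed.

Definition is_cderive (z : R -> C) (t : R) (d : C) :=
  is_derive t 1 (Re \o z) (Re d) /\
  is_derive t 1 (Im \o z) (Im d).

Lemma is_cderiveM (y z : R -> C) t dy dz : is_cderive y t dy ->
  is_cderive z t dz ->
  is_cderive (fun t => y t * z t) t (dy * z t + y t * dz).
Proof.
move=> [yr yi] [zr zi]; split.
  rewrite (_ : _ \o _ = (Re \o y) * (Re \o z) -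
                        (Im \o y) * (Im \o z)); last first.
    by apply/funext => s /=; rewrite cReM.
  apply: is_derive_eq (is_deriveB (is_deriveM yr zr) (is_deriveM yi zi)) _.
  by rewrite /= !cReImE /GRing.scale /=; ring.
rewrite (_ : _ \o _ = (Re \o y) * (Im \o z) +
                      (Im \o y) * (Re \o z)); last first.
  by apply/funext => s /=; rewrite cImM.
apply: is_derive_eq (is_deriveD (is_deriveM yr zi) (is_deriveM yi zr)) _.
by rewrite /= !cReImE /GRing.scale /=; ring.
Qed.

Lemma is_cderive_continuous (z d : R -> C) :
  (forall t, is_cderive z t (d t)) -> ccontinuous z.
Proof.
by move=> zd; split=> t; apply/differentiable_continuous/derivable1_diffP;
  case: (zd t) => -[? _] [? _].
Qed.

End LineIntegrals.

Section Poisson.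
Variable R : realType.
Local Notation C := R[i].
Local Notation Re := (@complex.Re R).
Local Notation Im := (@complex.Im R).
Local Notation mu := (@lebesgue_measure R).
Variable w : C.
Hypothesis w_gt0 : 0 < Im w.
Let u := Re w.
Let v := Im w.

(** The Poisson kernel without its factor [1 / pi]; in this normalization it is minus the imaginary
    part of the Cauchy kernel [1 / (w - t)]. *)
Definition poisson (t : R) : R :=
  Im w / ((t - Re w) ^+ 2 + Im w ^+ 2).

Let D t := (t - u) ^+ 2 + v ^+ 2.

Let D_gt0 t : 0 < D t.
Proof. by rewrite ltr_wpDl ?sqr_ge0// exprn_gt0. Qed.

Let D_neq0 t : D t != 0.
Proof. by rewrite gt_eqF. Qed.

Lemma poisson_gt0 t : 0 < poisson t.
Proof. by rewrite divr_gt0// D_gt0. Qed.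

Let om (t : R) : C := cayley w t%:C.

Let omE t : om t = (1 - 2 * v ^+ 2 / D t) +i* (- (2 * v * (t - u) / D t)).
Proof.
have tw : t%:C - conjc w != 0 by apply: cayley_den_neq0 => /=.
apply: (mulIf tw); rewrite /om /cayley divfK// /v /u /D.
move: (D_neq0 t); rewrite /D /u /v; case: (w) => a b /= D0.
by apply: complex_eqP; rewrite !cReImE /=; field.
Qed.

(** The logarithmic derivative of [om] is [1 / (t - w) - 1 / (t - conjc w) = 2i * poisson t]. Hence
    [poisson * om ^+ n] has the explicit primitive [om ^+ n / (2in)] for positive [n]. *)
Let is_derive_om t : is_cderive om t ('i * (2 * poisson t)%:C * om t).
Proof.
have dD : is_derive t 1 D (2 * (t - u)).
  rewrite (_ : D = (id - cst u) ^+ 2 + cst (v ^+ 2)); last exact/funext.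
  by apply: is_derive_eq; rewrite /GRing.scale /= !fctE; ring.
have dV : is_derive t 1 (fun x => (D x)^-1) (- (D t) ^- 2 * (2 * (t - u))).
  by apply: (is_derive_eq (is_deriveV (D_neq0 t) dD)); rewrite /GRing.scale /=.
have dm : is_derive t 1 (fun x => 2 * v * (x - u)) (2 * v).
  rewrite (_ : (fun _ => _) = (2 * v) \*: (id - cst u)); last exact/funext.
  by apply: is_derive_eq; rewrite /GRing.scale /=; ring.
split.
  rewrite (_ : _ \o _ = cst 1 - (2 * v ^+ 2) \*: (fun x => (D x)^-1)); last first.
    by apply/funext => x; rewrite /= omE.
  apply: is_derive_eq; rewrite /GRing.scale /= omE !cReImE /= /poisson -/u -/v -/(D t).
  by field.
rewrite (_ : _ \o _ = - ((fun x => 2 * v * (x - u)) * (fun x => (D x)^-1))); last first.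
  by apply/funext => x; rewrite /= omE.
apply: is_derive_eq; rewrite /GRing.scale /= omE !cReImE /= /poisson -/u -/v -/(D t).
by move: (D_neq0 t); rewrite /D => D0; field.
Qed.

Let is_derive_omX n t :
  is_cderive (fun t => om t ^+ n) t (n%:R * 'i * (2 * poisson t)%:C * om t ^+ n).
Proof.
elim: n => [|n IH].
  rewrite mul0r !mul0r; under eq_fun do rewrite expr0.
  by split; exact: is_derive_cst.
under eq_fun do rewrite exprS.
have -> : n.+1%:R * 'i * (2 * poisson t)%:C * om t ^+ n.+1 =
  ('i * (2 * poisson t)%:C * om t) * om t ^+ n +
  om t * (n%:R * 'i * (2 * poisson t)%:C * om t ^+ n).
  by rewrite exprS -natr1; ring.
exact: (@is_cderiveM _ om (fun t => om t ^+ n) _ _ _ (is_derive_om t) IH).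
Qed.

Let om_cont : ccontinuous om.
Proof. by apply: is_cderive_continuous => t; exact: is_derive_om. Qed.

Let omX_cont n : ccontinuous (fun t => om t ^+ n).
Proof. by apply: is_cderive_continuous => t; exact: is_derive_omX. Qed.

Lemma continuous_poisson : continuous poisson.
Proof.
move=> t; apply: cvgM; first exact: cvg_cst.
apply: cvgV; first exact: D_neq0.
apply: (@cvgD _ R^o); last exact: cvg_cst.
by apply: cvgM; apply: (@cvgB _ R^o); [exact: cvg_id|exact: cvg_cst|
  exact: cvg_id|exact: cvg_cst].
Qed.

(** The constant comes from [t ^+ 2 <= 2 (t - u) ^+ 2 + 2 u ^+ 2], each part being compared with the
    denominator. *)
Lemma poisson_le t :
  poisson t <= (v * (2 + (1 + 2 * u ^+ 2) / v ^+ 2)) / (1 + t ^+ 2).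
Proof.
have t1 : 0 < 1 + t ^+ 2 by rewrite ltr_pwDl// sqr_ge0.
have v0 : 0 < v := w_gt0.
rewrite /poisson -/u -/v -/(D t) -mulrA ler_pM2l// ler_pdivlMr//.
rewrite ler_pdivrMl ?D_gt0//; apply: (@le_trans _ _ (2 * (t - u) ^+ 2 + (1 + 2 * u ^+ 2))).
  by have := sqr_ge0 (t - 2 * u); nra.
have h : 0 <= (1 + 2 * u ^+ 2) / v ^+ 2.
  by rewrite divr_ge0 ?sqr_ge0// addr_ge0// mulr_ge0// sqr_ge0.
have e : (1 + 2 * u ^+ 2) / v ^+ 2 * v ^+ 2 = 1 + 2 * u ^+ 2.
  by rewrite divfK// gt_eqF// exprn_gt0.
have h1 : 0 <= (t - u) ^+ 2 * ((1 + 2 * u ^+ 2) / v ^+ 2).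
  by rewrite mulr_ge0 ?sqr_ge0.
have h2 := sqr_ge0 v.
rewrite /D; nra.
Qed.

Lemma Im_cauchy_kernel t : Im ((w - t%:C)^-1) = - poisson t.
Proof.
rewrite cImV normc_sqr !cImD !cImN !cReD !cReN /= subr0 /poisson.
by rewrite -[(t - _) ^+ 2]sqrrN opprB mulNr.
Qed.

Lemma Re_cauchy_kernel t :
  Re ((w - t%:C)^-1) = (Im w)^-1 * ((Re w - t) * poisson t).
Proof.
rewrite cReV normc_sqr !cImD !cImN !cReD !cReN /= subr0 /poisson.
rewrite -[(t - _) ^+ 2]sqrrN opprB [RHS]mulrCA; congr (_ * _).
by rewrite mulKf// gt_eqF.
Qed.

Lemma Im_le_dist t : Im w <= normc (w - t%:C).
Proof.
rewrite (le_trans _ (Im_le_normc _))// !cReImE /= subr0 ger0_norm//.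
exact: ltW.
Qed.

Lemma normc_cauchy_kernel t : normc ((w - t%:C)^-1) <= (Im w)^-1.
Proof.
by rewrite normcV lef_pV2 ?posrE ?Im_le_dist// (lt_le_trans w_gt0)// Im_le_dist.
Qed.

Lemma measurable_Im_cauchy_kernel :
  measurable_fun setT (fun t : R => Im ((w - t%:C)^-1)).
Proof.
rewrite (funext Im_cauchy_kernel); apply: measurableT_comp => //.
exact: continuous_measurable_fun continuous_poisson.
Qed.

Lemma measurable_Re_cauchy_kernel :
  measurable_fun setT (fun t : R => Re ((w - t%:C)^-1)).
Proof.
rewrite (funext Re_cauchy_kernel); do 2 apply: measurable_funM => //.
  exact: measurable_funB.
exact: continuous_measurable_fun continuous_poisson.
Qed.

Lemma integrable_poissonM (h : R -> R) (M : R) : measurable_fun setT h ->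
  (forall t, `|h t| <= M) ->
  mu.-integrable setT (EFin \o (fun t => poisson t * h t)).
Proof.
move=> mh hM; have mp := continuous_measurable_fun continuous_poisson.
have M0 : 0 <= M by rewrite (le_trans _ (hM 0)).
apply: (@integrable_le_oneDsqrV _ _ (v * (2 + (1 + 2 * u ^+ 2) / v ^+ 2) * M)).
  exact: measurable_funM.
move=> t; rewrite normrM (ger0_norm (ltW (poisson_gt0 t))) [leRHS]mulrAC.
by rewrite ler_pM// ?poisson_le// ltW// poisson_gt0.
Qed.

Let om_le1 t : normc (om t) <= 1.
Proof. by apply: cayley_le1. Qed.

Let horner_om_cont (p : {poly C}) : ccontinuous (fun t => p.[om t]).
Proof.
elim/poly_ind: p => [|p c IH].
  by under eq_fun do rewrite horner0; exact: ccontinuous_cst.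
under eq_fun do rewrite hornerMXaddC.
by apply: ccontinuousD (ccontinuous_cst _); exact: ccontinuousM.
Qed.

Let integrable_horner (p : {poly C}) :
  mu.-integrable setT (EFin \o (fun t => poisson t * Im (p.[om t]))).
Proof.
have [M M0 pM] := normc_horner_bound p.
apply: (@integrable_poissonM _ M).
  by apply: continuous_measurable_fun; have [] := horner_om_cont p.
by move=> t; rewrite (le_trans (Im_le_normc _))// pM.
Qed.

Let integrable_hornerX (p : {poly C}) n : mu.-integrable setT
  (EFin \o (fun t => poisson t * Im (p.[om t] * om t ^+ n))).
Proof.
have := integrable_horner (p * 'X^n).
by under eq_fun do rewrite hornerM hornerXn.
Qed.

Lemma Rintegral_poisson : \int[mu]_t poisson t = pi.
Proof.
apply: (@Rintegral_line_FTC _ _ (fun t => atan ((t - u) / v))).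
- exact: continuous_poisson.
- move=> t.
  have dm : is_derive t 1 (fun x => (x - u) / v) v^-1.
    rewrite (_ : (fun _ => _) = v^-1 \*: (id - cst u)); last first.
      by apply/funext => x /=; rewrite mulrC.
    by apply: is_derive_eq; rewrite /GRing.scale /=; ring.
  have v0 : v != 0 by rewrite gt_eqF.
  apply: is_derive_eq; rewrite /poisson -/u -/v; move: (D_neq0 t); rewrite /D => D0.
  have aux (a b : R) : b != 0 -> a ^+ 2 + b ^+ 2 != 0 ->
      (1 + (a / b) ^+ 2)^-1 / b = b / (a ^+ 2 + b ^+ 2).
    move=> b0 ab0; rewrite (_ : 1 + _ = (a ^+ 2 + b ^+ 2) / b ^+ 2); last by field.
    by rewrite invf_div; field; rewrite ab0 b0.
  exact: aux.
- have := @integrable_poissonM (cst 1) 1 (measurable_cst _).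
  by under eq_fun do rewrite mulr1; apply=> t; rewrite normr1.
- have A : (fun n : nat => atan ((n%:R - u) / v)) @ \oo --> pi / 2.
    apply: (cvg_comp _ (@atan R) _ (@cvgy_atan R)).
    apply/cvgryPge => A; near=> n; rewrite ler_pdivlMr// lerBrDr.
    by near: n; exact: nbhs_infty_ger.
  have B : (fun n : nat => atan ((- n%:R - u) / v)) @ \oo --> - (pi / 2).
    have -> : (fun n : nat => atan ((- n%:R - u) / v)) =
              (fun n : nat => - atan ((n%:R + u) / v)).
      by apply/funext => n; rewrite -atanN -mulNr opprD.
    apply: cvgN; apply: (cvg_comp _ (@atan R) _ (@cvgy_atan R)).
    apply/cvgryPge => B; near=> n; rewrite ler_pdivlMr// -lerBlDr.
    by near: n; exact: nbhs_infty_ger.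
  rewrite [X in _ --> X](splitr pi) -[X in _ + X]opprK.
  exact: (@cvgB _ R^o _ _ _ _ _ _ _ A B).
Unshelve. all: by end_near. Qed.

(** The primitive is a multiple of [om ^+ n.+1], and [om] tends to 1 at both ends of the line, so
    the boundary terms cancel. *)
Lemma Rintegral_poisson_monomial (c : C) n :
  \int[mu]_t (poisson t * Im (c * om t ^+ n.+1)) = 0.
Proof.
pose b : C := c / (n.+1%:R * 'i * 2%:R).
have n0 : n.+1%:R * 'i * 2%:R != 0 :> C.
  rewrite !mulf_neq0 ?pnatr_eq0//.
  by apply: Im_gt0_neq0 => /=; exact: ltr01.
have dH t : is_cderive (fun t => b * om t ^+ n.+1) t
    ((poisson t)%:C * (c * om t ^+ n.+1)).
  have -> : (poisson t)%:C * (c * om t ^+ n.+1) = 0 * om t ^+ n.+1 +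
     b * (n.+1%:R * 'i * (2 * poisson t)%:C * om t ^+ n.+1).
    have -> : (2 * poisson t)%:C = 2%:R * (poisson t)%:C :> C.
      by rewrite [LHS](rmorphM (real_complex R)) (rmorph_nat (real_complex R)).
    rewrite /b mul0r add0r.
    have -> : n.+1%:R * 'i * (2%:R * (poisson t)%:C) =
      n.+1%:R * 'i * 2%:R * (poisson t)%:C :> C by rewrite !mulrA.
    by move: (_ * _ * 2%:R) n0 => K K0; field.
  by apply: is_cderiveM (is_derive_omX _ _); split; exact: is_derive_cst.
apply: (@Rintegral_line_FTC _ _ (Im \o (fun t => b * om t ^+ n.+1))).
- move=> t; apply: cvgM; first exact: continuous_poisson.
  by have [_] := ccontinuousM (ccontinuous_cst c) (omX_cont n.+1); apply.
- move=> t; have [_] := dH t; rewrite cImM /= mul0r addr0.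
  by apply.
- have := integrable_hornerX c%:P n.+1.
  by under eq_fun do rewrite hornerC.
(* Since [|om t - 1| ^+ 2 = 4 v * poisson t], the decay of the kernel gives a rate of order [1 / n]
   at [t = n] and [t = - n]. *)
- have [M M0 omM] : exists2 M : R, 0 <= M & forall (n : nat) (t : R),
      `|t| = n%:R -> normc (om t - 1) <= M / n.+1%:R.
    have v0 : 0 < v := w_gt0.
    pose K := v * (2 + (1 + 2 * u ^+ 2) / v ^+ 2).
    have K0 : 0 <= K.
      apply: mulr_ge0; first exact: ltW.
      by rewrite addr_ge0// divr_ge0 ?sqr_ge0// addr_ge0// mulr_ge0// sqr_ge0.
    have vK0 : 0 <= 8 * v * K.
      by apply: mulr_ge0 => //; apply: mulr_ge0 => //; exact: ltW.
    exists (Num.sqrt (8 * v * K)); first exact: sqrtr_ge0.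
    move=> m t tm.
    rewrite -(ler_pXn2r (n := 2)) ?nnegrE ?normc_ge0 ?divr_ge0 ?sqrtr_ge0//.
    rewrite exprMn exprVn sqr_sqrtr//.
    have -> : normc (om t - 1) ^+ 2 = 4 * v * poisson t.
      rewrite normc_sqr omE !cReImE /= /poisson -/u -/v; move: (D_neq0 t).
      by rewrite /D => D0; field.
    apply: (@le_trans _ _ (4 * v * (K / (1 + t ^+ 2)))).
      by rewrite ler_pM2l ?mulr_gt0// poisson_le.
    have t2 : t ^+ 2 = m%:R ^+ 2 by rewrite -tm real_normK ?num_real.
    have m1 : 0 < m.+1%:R ^+ 2 :> R by rewrite exprn_gt0.
    have t10 : 0 < 1 + m%:R ^+ 2 :> R by rewrite ltr_pwDl// sqr_ge0.
    have h (k : R) : 0 <= k -> k / (1 + m%:R ^+ 2) * m.+1%:R ^+ 2 <= k * 2.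
      move=> k0; rewrite mulrAC ler_pdivrMr// -mulrA ler_wpM2l// -natr1.
      by have := sqr_ge0 (m%:R - 1 : R); nra.
    rewrite t2 ler_pdivlMr// (_ : 8 * v * K = 4 * v * (K * 2)); last by ring.
    by rewrite -[leLHS]mulrA ler_pM2l ?mulr_gt0// h.
  have X1 k (z : C) : normc z <= 1 -> normc (z ^+ k - 1) <= k%:R * normc (z - 1).
    move=> z1; elim: k => [|k IH]; first by rewrite expr0 subrr normc0 mul0r.
    have -> : z ^+ k.+1 - 1 = z * (z ^+ k - 1) + (z - 1) by rewrite exprS; ring.
    rewrite (le_trans (ler_normcD _ _))// -natr1 mulrDl mul1r lerD2r normcM.
    by rewrite (le_trans _ IH)// ler_piMl ?normc_ge0.
  pose K := normc b * (n.+1%:R * (M + M)).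
  apply: norm_cvg0.
  apply: (@squeeze_cvgr _ _ _ _ (fun=> 0) (fun n : nat => K * harmonic n)).
  + apply: nearW => m; rewrite normr_ge0 /= -cImN -cImD (le_trans (Im_le_normc _))//.
    rewrite -mulrN -mulrDr normcM /K -mulrA ler_wpM2l ?normc_ge0//.
    rewrite (le_trans (normc_dist_trans 1 _ _))//.
    rewrite (normc_distC 1) -mulrA mulrDl mulrDr lerD//;
      rewrite (le_trans (X1 _ _ (om_le1 _)))// ler_wpM2l// omM ?normrN ?normr_nat//.
  + exact: cvg_cst.
  + by rewrite -(mulr0 K); apply: cvgM; [exact: cvg_cst|exact: cvg_harmonic].
Qed.

(** Positive powers of [om] integrate to 0, so only the constant coefficient [p.[0]] survives. *)
Lemma Rintegral_poisson_horner (p : {poly C}) :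
  \int[mu]_t (poisson t * Im (p.[om t])) = pi * Im p.[0].
Proof.
(* The exponent [k] is left free because peeling [q = q' * 'X + c] raises it by one. *)
have H q : forall k, \int[mu]_t (poisson t * Im (q.[om t] * om t ^+ k.+1)) = 0.
  elim/poly_ind: q => [|q c IH] k.
    rewrite (@eq_Rintegral _ _ _ mu setT (fun t => 0 * poisson t)); last first.
      by move=> t _; rewrite horner0 mul0r mulr0 mul0r.
    rewrite RintegralZl ?mul0r//.
    have := @integrable_poissonM (cst 1) 1 (measurable_cst _).
    by under eq_fun do rewrite mulr1; apply=> t; rewrite normr1.
  rewrite (@eq_Rintegral _ _ _ mu setT (fun t => poisson t * Im (q.[om t] * om t ^+ k.+2) +
    poisson t * Im (c * om t ^+ k.+1))); last first.
    by move=> t _; rewrite -mulrDr -cImD hornerMXaddC mulrDl -mulrA -exprS.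
  rewrite RintegralD//.
  - by rewrite IH Rintegral_poisson_monomial addr0.
  - have := integrable_hornerX c%:P k.+1.
    by under eq_fun do rewrite hornerC.
elim/poly_ind: p => [|p c _].
  rewrite (@eq_Rintegral _ _ _ mu setT (fun t => 0 * poisson t)); last first.
    by move=> t _; rewrite horner0 mulr0 mul0r.
  rewrite horner0 mulr0 RintegralZl ?mul0r//.
  have := @integrable_poissonM (cst 1) 1 (measurable_cst _).
  by under eq_fun do rewrite mulr1; apply=> t; rewrite normr1.
have ip : mu.-integrable setT (EFin \o poisson).
  have := @integrable_poissonM (cst 1) 1 (measurable_cst _).
  by under eq_fun do rewrite mulr1; apply=> t; rewrite normr1.
rewrite (@eq_Rintegral _ _ _ mu setT (fun t => poisson t * Im (p.[om t] * om t ^+ 1) +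
    Im c * poisson t)); last first.
  by move=> t _; rewrite hornerMXaddC cImD mulrDr expr1 [Im c * _]mulrC.
rewrite RintegralD//.
- by rewrite H RintegralZl// Rintegral_poisson hornerMXaddC mulr0 !add0r mulrC.
- by have := integrableZl measurableT (Im c) ip.
Qed.

(** Approximation is uniform on the closed half plane, so one polynomial controls both the integral
    over the line and the value at [w], where the Cayley variable is 0. *)
Lemma poisson_formula (Phi : C -> C) : disc_algebra w Phi ->
  measurable_fun setT (fun t : R => Im (Phi t%:C)) ->
  \int[mu]_t (poisson t * Im (Phi t%:C)) = pi * Im (Phi w).
Proof.
move=> A mPhi; apply/eqP; rewrite -subr_eq0 -normr_le0; apply/ler_addgt0Pr => e e0.
rewrite add0r; have pi0 := pi_gt0 R.
(* The integral and the value at [w] each contribute an error [pi * d]. *)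
have d0 : 0 < e / (2 * pi) by rewrite divr_gt0// mulr_gt0.
have [p pP] := A _ d0; set d := e / _ in d0 pP.
have [M M0 PhiM] := disc_algebra_bounded w_gt0 A.
have iPhi : mu.-integrable setT (EFin \o (fun t => poisson t * Im (Phi t%:C))).
  apply: (@integrable_poissonM _ M) => // t.
  by rewrite (le_trans (Im_le_normc _))// PhiM.
have ip : mu.-integrable setT (EFin \o poisson).
  have := @integrable_poissonM (cst 1) 1 (measurable_cst _).
  by under eq_fun do rewrite mulr1; apply=> t; rewrite normr1.
have -> : \int[mu]_t (poisson t * Im (Phi t%:C)) - pi * Im (Phi w) =
  \int[mu]_t (poisson t * Im (Phi t%:C) - poisson t * Im (p.[om t])) -
  pi * (Im (Phi w) - Im p.[0]).
  by rewrite RintegralB// Rintegral_poisson_horner; ring.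
rewrite (le_trans (ler_normB _ _))//.
have -> : e = d * pi + pi * d.
  by rewrite [pi * d]mulrC -mulrDr -mulr2n -mulr_natl divfK// mulf_neq0 ?gt_eqF.
apply: lerD; last first.
  rewrite normrM gtr0_norm// ler_pM2l// -cImN -cImD (le_trans (Im_le_normc _))//.
  have := pP w (ltW w_gt0).
  by rewrite /cayley subrr mul0r.
have id : mu.-integrable setT (EFin \o (fun t =>
    poisson t * Im (Phi t%:C) - poisson t * Im (p.[om t]))).
  by have := integrableB measurableT iPhi (integrable_horner p).
rewrite (le_trans (le_normr_Rintegral _ id))//.
rewrite -Rintegral_poisson -RintegralZl//; apply: le_Rintegral => //.
- by have := integrable_abse id.
- by have := integrableZl measurableT d ip.
move=> t _; rewrite -mulrBr normrM (gtr0_norm (poisson_gt0 t)) mulrC.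
rewrite ler_pM2r ?poisson_gt0// -cImN -cImD (le_trans (Im_le_normc _))//.
exact: pP.
Qed.

End Poisson.

(** * Probability measures with a density *)

Record prob_density (R : realType) := ProbDensity {
  density :> R -> R;
  density_measurable : measurable_fun setT density;
  density_ge0 : forall x, 0 <= density x;
  density_integral : (\int[@lebesgue_measure R]_x (density x)%:E = 1)%E }.

Definition density_prob (R : realType) (p : prob_density R)
    (V : set (measurableTypeR R)) : \bar R :=
  (\int[@lebesgue_measure R]_(x in V) (p x)%:E)%E.

Section DensityProb.
Variable R : realType.
Local Notation mu := (@lebesgue_measure R).
Variable p : prob_density R.

Lemma measurable_density (A : set (measurableTypeR R)) :
  measurable_fun A (fun x => (p x)%:E).
Proof.
apply/measurable_funTS/measurableT_comp; first exact: EFin_measurable.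
exact: density_measurable.
Qed.

Lemma integrable_density : mu.-integrable setT (EFin \o p).
Proof.
apply/integrableP; split; first exact: measurable_density.
under eq_integral do rewrite /= ger0_norm ?density_ge0//.
by rewrite density_integral ltry.
Qed.

Let density_prob0 : density_prob p set0 = 0%E.
Proof. by rewrite /density_prob integral_set0. Qed.

Let density_prob_ge0 A : (0 <= density_prob p A)%E.
Proof. by apply: integral_ge0 => x _; rewrite lee_fin density_ge0. Qed.

Let density_prob_sigma_additive : semi_sigma_additive (density_prob p).
Proof.
move=> /= A mA tA mUA; rewrite /density_prob integral_bigcup//=; last first.
  exact: integrableS (subsetT _) integrable_density.
apply: is_cvg_ereal_nneg_natsum_cond => n _ _.
exact: density_prob_ge0.
Qed.

HB.instance Definition _ := isMeasure.Build _ _ _ (density_prob p)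
  density_prob0 density_prob_ge0 density_prob_sigma_additive.

Let density_prob_setT : density_prob p setT = 1%E.
Proof. exact: density_integral. Qed.

HB.instance Definition _ :=
  @Measure_isProbability.Build _ _ R (density_prob p) density_prob_setT.

Lemma density_prob_dominates : density_prob p `<< mu.
Proof.
apply/null_content_dominatesP => A mA muA0; rewrite /density_prob.
apply: null_set_integral => //.
exact: measurable_density.
Qed.

(** Change of variables holds with the Radon-Nikodym derivative, which equals [p] almost everywhere
    because both have the same integral over every measurable set. *)
Lemma integral_density_prob (f : R -> R) (M : R) : measurable_fun setT f ->
  (forall x, `|f x| <= M) ->
  (\int[density_prob p]_x (f x)%:E = \int[mu]_x (f x * p x)%:E)%E.
Proof.
move=> mf fM.
have intf : (density_prob p).-integrable setT (EFin \o f).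
  apply: measurable_bounded_integrable => //.
    by rewrite -ge0_fin_numE// fin_num_measure.
  exists M; split; first exact: num_real.
  by move=> x Mx y _ /=; rewrite (le_trans (fM y))// ltW.
rewrite -(Radon_Nikodym_change_of_variables density_prob_dominates)//=.
under [RHS]eq_integral do rewrite EFinM.
apply: ae_eq_integral => //.
- apply: emeasurable_funM; first exact/measurable_EFinP.
  apply: (measurable_int mu).
  by apply: Radon_Nikodym_integrable; exact: density_prob_dominates.
- by apply: emeasurable_funM; [exact/measurable_EFinP|exact: measurable_density].
- apply: ae_eqe_mul2l => /=.
  rewrite Radon_NikodymE//=; first exact: density_prob_dominates.
  move=> dom; case: cid => /= h [h1 h2 h3].
  apply: integral_ae_eq => //=.
  + exact: measurable_density.
  + by move=> E _ mE; rewrite -h3.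
Qed.

End DensityProb.

Section Reflection.
Variable R : realType.
Local Notation mu := (@lebesgue_measure R).

(** By uniqueness of Lebesgue measure it suffices to test half-open intervals; reflection moves the
    closed endpoint to the other side, which does not change the length. *)
Lemma lebesgue_measure_opp (A : set (measurableTypeR R)) : measurable A ->
  pushforward mu (-%R : measurableTypeR R -> measurableTypeR R) A = mu A.
Proof.
have mN : measurable_fun setT (-%R : measurableTypeR R -> measurableTypeR R).
  by [].
pose nu := measure_function_pushforward__canonical__measure_function_Measure mu mN.
move=> mA; apply/esym; apply: (@lebesgue_measure_unique R nu) => // X [[a b] _ <-].
rewrite /nu /= /pushforward.
have -> : -%R @^-1` `]a, b]%classic = `[- b, - a[%classic :> set R.
  by apply/seteqP; split => x /=; rewrite !in_itv /=; lra.
rewrite !lebesgue_measure_itv /= !lte_fin ltrN2; case: ifPn => // _.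
by rewrite -!EFinB opprK addrC.
Qed.

Lemma density_prob_symmetric (p : prob_density R) :
  (forall x, p (- x) = p x) -> symmetric_prob (density_prob p).
Proof.
move=> pN A mA.
have mN : measurable_fun setT (-%R : measurableTypeR R -> measurableTypeR R).
  by [].
rewrite /= /density_prob.
transitivity (\int[pushforward mu (-%R : measurableTypeR R -> measurableTypeR R)]_(x in A)
   (p x)%:E)%E; last first.
  apply: eq_measure_integral => B mB _; exact: lebesgue_measure_opp.
rewrite ge0_integral_pushforward//=.
- by apply: eq_integral => x _; rewrite pN.
- exact: measurable_density.
- by move=> x _; rewrite lee_fin density_ge0.
Qed.

End Reflection.

(** * Limits of sequences with geometrically decaying increments *)

Section GeometricLimits.
Variable R : realType.
Local Notation C := R[i].

(** With [c k] the geometric tail of all increments from [k] on, the intervals of centre [x k] and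
    radius [c k] are nested; the limit is the supremum of their left ends. *)
Lemma real_geometric_limit (x : nat -> R) (M : R) : 
  (forall k, `|x k.+1 - x k| <= M / 4 ^+ k) ->
  exists l, forall k, `|l - x k| <= 4 / 3 * M / 4 ^+ k.
Proof.
move=> xM; have M0 : 0 <= M.
  by have := xM 0%N; rewrite expr0 divr1; apply: le_trans.
pose c k : R := 4 / 3 * M / 4 ^+ k.
have c0 k : 0 <= c k by rewrite divr_ge0// mulr_ge0.
have cS k : c k.+1 = c k - M / 4 ^+ k.
  have : (4 : R) ^+ k != 0 by rewrite expf_neq0.
  by rewrite /c exprS => h; field.
have up : nondecreasing_seq (fun k => x k - c k).
  apply/nondecreasing_seqP => k; rewrite cS.
  by have := xM k; rewrite ler_norml => /andP[+ _]; lra.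
have down : nonincreasing_seq (fun k => x k + c k).
  apply/nonincreasing_seqP => k; rewrite cS.
  by have := xM k; rewrite ler_norml => /andP[_ +]; lra.
have le j k : x j - c j <= x k + c k.
  apply: (@le_trans _ _ (x (maxn j k) - c (maxn j k))).
    by apply: up; exact: leq_maxl.
  apply: (@le_trans _ _ (x (maxn j k) + c (maxn j k))).
    by have := c0 (maxn j k); lra.
  by apply: down; exact: leq_maxr.
exists (sup (range (fun k => x k - c k))) => k; rewrite -/(c k) ler_distl.
apply/andP; split.
  apply: ub_le_sup; last by exists k.
  by exists (x k + c k) => _ [j _ <-].
apply: ge_sup; first by exists (x k - c k), k.
by move=> _ [j _ <-].
Qed.

Lemma complex_geometric_limit (z : nat -> C) (M : R) :
  (forall k, normc (z k.+1 - z k) <= M / 4 ^+ k) ->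
  exists l, forall k, normc (l - z k) <= 4 * M / 4 ^+ k.
Proof.
move=> zM.
have M0 : 0 <= M.
  by have := zM 0%N; rewrite expr0 divr1; apply: le_trans; exact: normc_ge0.
have [|a aP] := @real_geometric_limit (fun k => complex.Re (z k)) M.
  by move=> k; rewrite -cReN -cReD (le_trans (Re_le_normc _)).
have [|b bP] := @real_geometric_limit (fun k => complex.Im (z k)) M.
  by move=> k; rewrite -cImN -cImD (le_trans (Im_le_normc _)).
exists (a +i* b) => k; rewrite (le_trans (normc_le_ReIm _))//.
rewrite cReD cReN cImD cImN /= (le_trans (lerD (aP k) (bP k)))//.
by rewrite -mulrDl ler_wpM2r ?invr_ge0 ?exprn_ge0//; lra.
Qed.

Lemma geometric_le0 (x K : R) : (forall k, x <= K / 4 ^+ k) -> x <= 0.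
Proof.
move=> H; apply/ler_addgt0Pr => e e0; rewrite add0r.
have [||k ke] := @geometric_small R 4^-1 K e; [lra|by []|].
by rewrite (le_trans (H k))// mulrC -exprVn.
Qed.

End GeometricLimits.

(** * Measures with a prescribed Voiculescu transform *)

Section Construction.
Variable R : realType.
Local Notation C := R[i].
Local Notation mu := (@lebesgue_measure R).
Local Notation Re := (@complex.Re R).
Local Notation Im := (@complex.Im R).
Variables (T : R) (g : C -> C).
Hypothesis T_gt0 : 0 < T.
Hypothesis g_bound : forall z, 2 * T <= Im z -> normc (g z) <= T / 2.
Hypothesis g_lip : forall z1 z2, 2 * T <= Im z1 -> 2 * T <= Im z2 ->
  normc (g z1 - g z2) <= normc (z1 - z2) / 4.
Hypothesis g_sym : forall z, 2 * T <= Im z -> g (- conjc z) = - conjc (g z).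
Let iA : C := 0 +i* (5 / 2 * T).
(** Plays the part of holomorphy of [g]: an iteration step must not leave the disc algebra. *)
Hypothesis g_algebra : forall w, 0 < Im w -> forall X, disc_algebra w X ->
  (forall s, 0 <= Im s -> normc (X s) <= T / 2) ->
  disc_algebra w (fun s => g (s + 0 +i* (5 / 2 * T) - X s)).

Let Im_shift s x : 0 <= Im s -> normc x <= T / 2 -> 2 * T <= Im (s + iA - x).
Proof.
move=> s0 xT; rewrite !cReImE /=.
have := le_trans (Im_le_normc x) xT; rewrite ler_norml => /andP[_].
lra.
Qed.

(** If the images agree, [|z1 - z2| = |g z2 - g z1| <= |z1 - z2| / 4]. *)
Lemma voiculescu_inj z1 z2 : 2 * T <= Im z1 -> 2 * T <= Im z2 ->
  z1 + g z1 = z2 + g z2 -> z1 = z2.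
Proof.
move=> h1 h2 e; apply/eqP; rewrite -subr_eq0 -normc_eq0.
rewrite eq_le normc_ge0 andbT.
have : z1 - z2 = g z2 - g z1.
  have -> : z1 - z2 = (z1 + g z1) - (z2 + g z2) + (g z2 - g z1) by ring.
  by rewrite e subrr add0r.
move=> e2; have := g_lip h2 h1; rewrite -e2 normc_distC; lra.
Qed.

(** The iteration is run on the correction [X = s + 5iT/2 - F], that is [X = g(F)], because [X] is
    bounded and can lie in the disc algebra while [F] cannot. *)
Fixpoint picard (k : nat) (s : C) : C :=
  if k is k'.+1 then g (s + 0 +i* (5 / 2 * T) - picard k' s) else 0.

Let picard_bound k s : 0 <= Im s -> normc (picard k s) <= T / 2.
Proof.
move=> s0; elim: k => [|k IH]; first by rewrite normc0 divr_ge0// ltW.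
by apply: g_bound; exact: Im_shift.
Qed.

Let picard_step k s : 0 <= Im s ->
  normc (picard k.+1 s - picard k s) <= T / 2 / 4 ^+ k.
Proof.
move=> s0; elim: k => [|k IH].
  by rewrite /= subr0 expr0 divr1; have := picard_bound 1 s0.
rewrite [picard k.+2 s]/= [X in _ - X]/=.
rewrite (le_trans (g_lip (Im_shift s0 (picard_bound k.+1 s0))
  (Im_shift s0 (picard_bound k s0))))//.
have -> : s + iA - picard k.+1 s - (s + iA - picard k s) =
  - (picard k.+1 s - picard k s) by ring.
by rewrite normc_opp exprSr invfM mulrA ler_pM2r.
Qed.

Lemma picard_limit : exists X : C -> C,
  (forall s, 0 <= Im s -> normc (X s) <= T / 2 /\
     X s = g (s + 0 +i* (5 / 2 * T) - X s)) /\
  forall w, 0 < Im w -> disc_algebra w X.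
Proof.
have H s : exists l, 0 <= Im s -> forall k, normc (l - picard k s) <= 4 * (T / 2) / 4 ^+ k.
  (* Below the real line the value is a dummy; only the closed half plane is ever inspected. *)
  have [s0|s0] := boolP (0 <= Im s); last by exists 0.
  have [l lP] := @complex_geometric_limit R (picard ^~ s) (T / 2) (fun k => picard_step k s0).
  by exists l.
have [X XP] := choice H; exists X.
have XT s : 0 <= Im s -> normc (X s) <= T / 2.
  move=> s0; rewrite -subr_le0; apply: (@geometric_le0 _ _ (4 * (T / 2))) => k.
  have := XP s s0 k; have := picard_bound k s0.
  by have := lerB_normc (X s) (picard k s); lra.
split=> [s s0|w w0].
  split; first exact: XT.
  apply/eqP; rewrite -subr_eq0 -normc_eq0 eq_le normc_ge0 andbT.
  apply: (@geometric_le0 _ _ (4 * T)) => k.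
  rewrite (le_trans (normc_dist_trans (picard k.+1 s) _ _))//.
  have h1 := XP s s0 k.+1.
  have h2 := g_lip (Im_shift s0 (picard_bound k s0)) (Im_shift s0 (XT s s0)).
  have e : s + iA - picard k s - (s + iA - X s) = X s - picard k s by ring.
  rewrite e in h2; have h3 := XP s s0 k.
  have h4 : (0 : R) <= T / 4 ^+ k by rewrite divr_ge0 ?exprn_ge0// ltW.
  rewrite exprSr invfM in h1.
  rewrite [picard k.+1 s]/= in h1 *; rewrite -/iA in h1 *.
  have -> : 4 * T / 4 ^+ k = 4 * (T / 4 ^+ k) by rewrite mulrA.
  move: h1 h3; rewrite !mulrA.
  have -> : 4 * T / 2 / 4 ^+ k = 2 * (T / 4 ^+ k) by field; rewrite expf_neq0.
  lra.
(* The error bound does not depend on [s], so a single iterate approximates the limit on the whole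
   closed half plane. *)
apply: (disc_algebra_lim (w := w)) => // e e0.
have [||k ke] := @geometric_small R 4^-1 (4 * (T / 2)) e; [lra|by []|].
exists (picard k); last first.
  by move=> s s0; rewrite (le_trans (XP s s0 k))// mulrC -exprVn.
elim: k {ke} => [|k IH] /=; first exact: disc_algebra_cst.
by apply: g_algebra => // s s0; exact: picard_bound.
Qed.

End Construction.

Section ConstructionMeasure.
Variable R : realType.
Local Notation C := R[i].
Local Notation mu := (@lebesgue_measure R).
Local Notation Re := (@complex.Re R).
Local Notation Im := (@complex.Im R).

Lemma lipschitz_continuous_real (f : R -> R) (K : R) :
  (forall x y, `|f x - f y| <= K * `|x - y|) -> continuous f.
Proof.
move=> fK x; apply/cvgrPdist_le => e e0.
have K0 : 0 < `|K| + 1 by rewrite ltr_wpDl.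
near=> y; rewrite (le_trans (fK x y))//.
apply: (@le_trans _ _ ((`|K| + 1) * `|x - y|)).
  by rewrite ler_wpM2r// (le_trans (ler_norm K))// lerDl.
rewrite -ler_pdivlMl//; near: y; apply: cvgr_dist_le; first exact: cvg_id.
by rewrite mulr_gt0 ?invr_gt0.
Unshelve. all: by end_near. Qed.

Variables (T : R) (g : C -> C).
Hypothesis T_gt0 : 0 < T.
Hypothesis g_bound : forall z, 2 * T <= Im z -> normc (g z) <= T / 2.
Hypothesis g_lip : forall z1 z2, 2 * T <= Im z1 -> 2 * T <= Im z2 ->
  normc (g z1 - g z2) <= normc (z1 - z2) / 4.
Hypothesis g_sym : forall z, 2 * T <= Im z -> g (- conjc z) = - conjc (g z).
Let iA : C := 0 +i* (5 / 2 * T).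

Section WithSolution.
Variable X : C -> C.
Hypothesis X_bound : forall s, 0 <= Im s -> normc (X s) <= T / 2.
Hypothesis X_eq : forall s, 0 <= Im s -> X s = g (s + iA - X s).
Hypothesis X_algebra : forall w, 0 < Im w -> disc_algebra w X.

Let F s := s + iA - X s.
Let G s := (F s)^-1.

Let F_im s : 0 <= Im s -> 2 * T + Im s <= Im (F s).
Proof.
move=> s0; rewrite /F !cReImE /=.
have := le_trans (Im_le_normc (X s)) (X_bound s0); rewrite ler_norml => /andP[_].
lra.
Qed.

Let F_im0 s : 0 <= Im s -> 2 * T <= Im (F s).
Proof. by move=> s0; rewrite (le_trans _ (F_im s0))// lerDl. Qed.

Let F_eq s : 0 <= Im s -> F s + g (F s) = s + iA.
Proof. by move=> s0; rewrite {2}/F -X_eq// /F subrK. Qed.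

Let F_neq0 s : 0 <= Im s -> F s != 0.
Proof.
by move=> s0; apply: Im_gt0_neq0; rewrite (lt_le_trans _ (F_im0 s0))// mulr_gt0.
Qed.

(** Subtracting the two equations leaves [F s1 - F s2] plus a perturbation at most a quarter of it,
    so [4/3] would do. Used for continuity, hence measurability, on the real line. *)
Let F_lip s1 s2 : 0 <= Im s1 -> 0 <= Im s2 ->
  normc (F s1 - F s2) <= 2 * normc (s1 - s2).
Proof.
move=> h1 h2; have e : F s1 - F s2 = s1 - s2 - (g (F s1) - g (F s2)).
  have -> : s1 - s2 = (s1 + iA) - (s2 + iA) by ring.
  by rewrite -!F_eq//; ring.
have := g_lip (F_im0 h1) (F_im0 h2).
have := normcB (s1 - s2) (g (F s1) - g (F s2)); rewrite -e.
by have := normc_ge0 (F s1 - F s2); lra.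
Qed.

Let cont_ReF : continuous (fun t : R => Re (F t%:C)).
Proof.
apply: (@lipschitz_continuous_real _ 2) => x y.
rewrite -cReN -cReD (le_trans (Re_le_normc _))//.
rewrite (le_trans (F_lip (s1 := x%:C) (s2 := y%:C) (lexx 0) (lexx 0)))//.
have -> : x%:C - y%:C = (x - y)%:C :> C by rewrite (rmorphB (real_complex R)).
by rewrite normc_real.
Qed.

Let cont_ImF : continuous (fun t : R => Im (F t%:C)).
Proof.
apply: (@lipschitz_continuous_real _ 2) => x y.
rewrite -cImN -cImD (le_trans (Im_le_normc _))//.
rewrite (le_trans (F_lip (s1 := x%:C) (s2 := y%:C) (lexx 0) (lexx 0)))//.
have -> : x%:C - y%:C = (x - y)%:C :> C by rewrite (rmorphB (real_complex R)).
by rewrite normc_real.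
Qed.

Let cont_normF : continuous (fun t : R => normc (F t%:C) ^+ 2).
Proof.
move=> t; rewrite (_ : (fun _ => _) = fun t => Re (F t%:C) * Re (F t%:C) +
    Im (F t%:C) * Im (F t%:C)); last first.
  by apply/funext => s; rewrite normc_sqr !expr2.
by apply: (@cvgD _ R^o); apply: cvgM; [exact: cont_ReF|exact: cont_ReF|
  exact: cont_ImF|exact: cont_ImF].
Qed.

Let normF2_neq0 (t : R) : normc (F t%:C) ^+ 2 != 0.
Proof. by rewrite expf_neq0// normc_eq0 F_neq0. Qed.

Let cont_ReG : continuous (fun t : R => Re (G t%:C)).
Proof.
rewrite (_ : (fun _ => _) = fun t : R => Re (F t%:C) / normc (F t%:C) ^+ 2).
  move=> t; apply: cvgM; first exact: cont_ReF.
  by apply: cvgV; [exact: normF2_neq0|exact: cont_normF].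
by apply/funext => t; rewrite /G cReV.
Qed.

Let cont_ImG : continuous (fun t : R => Im (G t%:C)).
Proof.
rewrite (_ : (fun _ => _) = fun t : R => - (Im (F t%:C) / normc (F t%:C) ^+ 2)).
  move=> t; apply: (@cvgN _ R^o); apply: cvgM; first exact: cont_ImF.
  by apply: cvgV; [exact: normF2_neq0|exact: cont_normF].
by apply/funext => t; rewrite /G cImV mulNr.
Qed.

Let mReG : measurable_fun setT (fun t : R => Re (G t%:C)).
Proof. exact: continuous_measurable_fun. Qed.

Let mImG : measurable_fun setT (fun t : R => Im (G t%:C)).
Proof. exact: continuous_measurable_fun. Qed.

Let G_algebra w : 0 < Im w -> disc_algebra w G.
Proof.
move=> w0; apply: (@disc_algebra_inv _ _ w0 X (5 / 2 * T) (T / 2)) => //.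
- by rewrite mulr_gt0.
- by have := T_gt0; lra.
- exact: X_algebra.
Qed.

(* [s G(s)] is bounded because [s = F(s) - iA + X(s)]. *)
Let sG s : 0 <= Im s -> s * G s = 1 + (X s - iA) * G s.
Proof.
move=> s0; apply: (mulIf (F_neq0 s0)).
by rewrite mulrDl mul1r -!mulrA mulVf ?F_neq0// !mulr1 /F; ring.
Qed.

Let sG_algebra w : 0 < Im w -> disc_algebra w (fun s => s * G s).
Proof.
move=> w0; apply: (disc_algebra_ext _ sG) => //.
apply: disc_algebraD => //; first exact: disc_algebra_cst.
apply: (disc_algebraM w0); last exact: G_algebra.
by apply: (disc_algebraB w0); [exact: X_algebra|exact: disc_algebra_cst].
Qed.

(** This is [(1 + s ^+ 2) * G s - (s - 'i)]: the factor [1 + s ^+ 2] cancels the Poisson kernel at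
    ['i], and [s - 'i] removes the growth at infinity. The product form shows membership in the disc
    algebra and the zero at ['i]. *)
Let Phi s := ('i - iA + X s) * (s * G s - 'i * G s).

Let Phi_algebra : disc_algebra 'i Phi.
Proof.
have i0 : 0 < Im ('i : C) by exact: ltr01.
apply: (disc_algebraM i0).
  by apply: disc_algebraD; [exact: disc_algebra_cst|exact: X_algebra].
apply: (disc_algebraB i0); first exact: sG_algebra.
by apply: (disc_algebraM i0); [exact: disc_algebra_cst|exact: G_algebra].
Qed.

Let Im_Phi (t : R) : Im (Phi t%:C) = Im (G t%:C) * (1 + t ^+ 2) + 1.
Proof.
have -> : Phi t%:C = G t%:C * (1 + t ^+ 2)%:C - (t%:C - 'i).
  apply: (mulIf (F_neq0 (s := t%:C) (lexx 0))); rewrite /Phi /G mulrBl.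
  have -> : 'i - iA + X t%:C = t%:C + 'i - F t%:C by rewrite /F; ring.
  have FV : (F t%:C)^-1 * F t%:C = 1 by rewrite mulVf// F_neq0.
  have -> : (1 + t ^+ 2)%:C = (t%:C + 'i) * (t%:C - 'i).
    by apply: complex_eqP; rewrite !cReImE /=; ring.
  have -> : (t%:C + 'i - F t%:C) * (t%:C / F t%:C - 'i / F t%:C) * F t%:C =
    (t%:C + 'i - F t%:C) * (t%:C - 'i) * ((F t%:C)^-1 * F t%:C) by ring.
  have -> : (F t%:C)^-1 * ((t%:C + 'i) * (t%:C - 'i)) * F t%:C =
    (t%:C + 'i) * (t%:C - 'i) * ((F t%:C)^-1 * F t%:C) by ring.
  by rewrite FV; ring.
by rewrite !cReImE /=; ring.
Qed.

Let poisson_i (t : R) : poisson 'i t = (1 + t ^+ 2)^-1.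
Proof. by rewrite /poisson /= subr0 expr1n addrC mul1r. Qed.

Let integrable_ImG : mu.-integrable setT (EFin \o (fun t : R => Im (G t%:C))).
Proof.
have [M M0 PhiM] := disc_algebra_bounded (ltr01 : 0 < Im ('i : C)) Phi_algebra.
apply: (@integrable_le_oneDsqrV _ _ (M + 1)) => // t.
have t0 : 0 < 1 + t ^+ 2 by rewrite ltr_pwDl// sqr_ge0.
rewrite ler_pdivlMr// -[X in _ * X]gtr0_norm// -normrM.
rewrite -[X in `|X|](addrK 1) -Im_Phi (le_trans (ler_normB _ _))// normr1 lerD2r.
by rewrite (le_trans (Im_le_normc _))// PhiM.
Qed.

(** Poisson's formula at ['i] for [Phi], which vanishes there, says that the integral of [Im G] plus
    that of the kernel, [pi], is 0. *)
Let Rintegral_ImG : \int[mu]_t Im (G t%:C) = - pi.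
Proof.
have i0 : 0 < Im ('i : C) by exact: ltr01.
have := poisson_formula i0 Phi_algebra.
have -> : Phi 'i = 0 by rewrite /Phi subrr mulr0.
rewrite mulr0 => H.
have e (t : R) : poisson 'i t * Im (Phi t%:C) = Im (G t%:C) + poisson 'i t.
  rewrite poisson_i Im_Phi; have : 1 + t ^+ 2 != 0.
    by rewrite gt_eqF// ltr_pwDl// sqr_ge0.
  by move=> t0; field.
move: H; under eq_Rintegral do rewrite e.
rewrite RintegralD//; last first.
  by rewrite (funext poisson_i : poisson 'i = _); exact: integrable_oneDsqrV.
rewrite Rintegral_poisson// => H; apply/eqP; rewrite -addr_eq0; apply/eqP; apply: H.
have -> : (fun t : R => Im (Phi t%:C)) = fun t => Im (G t%:C) * (1 + t ^+ 2) + 1.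
  by apply/funext => t; exact: Im_Phi.
by apply: measurable_funD => //; apply: measurable_funM => //; apply: measurable_funD.
Qed.

(** The Stieltjes inversion density [- Im (1/F) / pi], in a form whose sign is visible. *)
Let p (t : R) : R := Im (F t%:C) / (pi * normc (F t%:C) ^+ 2).

Let pE t : p t = - pi^-1 * Im (G t%:C).
Proof. by rewrite /p /G cImV invfM; ring. Qed.

Let p_ge0 t : 0 <= p t.
Proof.
apply: divr_ge0; last by rewrite mulr_ge0 ?pi_ge0// exprn_ge0// normc_ge0.
by rewrite (le_trans _ (F_im0 _))//= mulr_ge0// ltW.
Qed.

Let mp : measurable_fun setT p.
Proof. by rewrite (funext pE); exact: measurable_funM. Qed.

Let p_int : (\int[mu]_x (p x)%:E = 1)%E.
Proof.
have ip : mu.-integrable setT (EFin \o p).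
  have := integrableZl measurableT (- pi^-1) integrable_ImG.
  by rewrite (funext pE).
have : \int[mu]_x p x = 1.
  under eq_Rintegral do rewrite pE.
  by rewrite RintegralZl// Rintegral_ImG mulrNN mulVf// gt_eqF// pi_gt0.
rewrite /Rintegral => H; rewrite -[LHS]fineK ?H//.
exact: integrable_fin_num.
Qed.

Let pd : prob_density R := ProbDensity mp p_ge0 p_int.

(** By the symmetry of [g] both sides solve the same equation in the half plane where [id + g] is
    injective. *)
Let F_sym s : 0 <= Im s -> F (- conjc s) = - conjc (F s).
Proof.
move=> s0; have s0' : 0 <= Im (- conjc s) by case: (s) s0 => a b /=; rewrite opprK.
apply: (voiculescu_inj g_lip).
- exact: F_im0.
- by have := F_im0 s0; case: (F s) => a b /=; rewrite opprK.
rewrite F_eq// g_sym ?F_im0// -opprD -conjc_D F_eq//.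
by rewrite conjc_D opprD; congr (_ + _); apply: complex_eqP; rewrite /= ?oppr0 ?opprK.
Qed.

Let pN t : pd (- t) = pd t.
Proof.
rewrite /= /p; have -> : (- t)%:C = - conjc (t%:C) :> C.
  by apply: complex_eqP; rewrite /= ?oppr0.
by rewrite F_sym//= normc_opp normcJ; case: (F t%:C) => a b /=; rewrite opprK.
Qed.

(** The imaginary part is Poisson's formula for [G]. The real part has kernel
    [(u - t) / v * poisson w t], and [(u - t) * Im G = Im ((w - t) G) - v * Re G]: Poisson's formula
    applies to [(w - s) G s], which vanishes at [w], and to ['i * G]. *)
Let cauchy_pd w : 0 < Im w -> cauchy_transform (density_prob pd) w = G w.
Proof.
move=> w0; pose u := Re w; pose v := Im w.
have v0 : 0 < v := w0.
have pi0 : pi != 0 :> R by rewrite gt_eqF// pi_gt0.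
have ReV (t : R) : Re ((w - t%:C)^-1) = v^-1 * ((u - t) * poisson w t).
  exact: Re_cauchy_kernel.
apply: complex_eqP => /=.
- rewrite /Rintegral (@integral_density_prob _ pd (fun t => Re ((w - t%:C)^-1)) v^-1); last 2 first.
  + exact: measurable_Re_cauchy_kernel.
  + by move=> t; rewrite (le_trans (Re_le_normc _))// normc_cauchy_kernel.
  rewrite -/(Rintegral mu setT (fun t => Re ((w - t%:C)^-1) * pd t)).
  have A1 : disc_algebra w (fun s => w * G s - s * G s).
    apply: (disc_algebraB w0); last exact: sG_algebra.
    by apply: (disc_algebraM w0); [exact: disc_algebra_cst|exact: G_algebra].
  have A2 : disc_algebra w (fun s => 'i * G s).
    by apply: (disc_algebraM w0); [exact: disc_algebra_cst|exact: G_algebra].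
  have E1 (t : R) : Im (w * G t%:C - t%:C * G t%:C) =
      (u - t) * Im (G t%:C) + v * Re (G t%:C).
    by rewrite !cReImE /= /u /v; ring.
  have E2 s : Im ('i * G s) = Re (G s) by rewrite !cReImE /=; ring.
  have m1 : measurable_fun setT (fun t : R => Im (w * G t%:C - t%:C * G t%:C)).
    rewrite (funext E1); apply: measurable_funD; apply: measurable_funM => //.
    exact: measurable_funB.
  have m2 : measurable_fun setT (fun t : R => Im ('i * G t%:C)).
    by rewrite (funext (fun t : R => E2 t%:C)).
  have P1 := poisson_formula w0 A1 m1.
  have P2 := poisson_formula w0 A2 m2.
  rewrite subrr mulr0 in P1; rewrite E2 in P2.
  have I1 : mu.-integrable setT (EFin \o (fun t : R => poisson w t * Im (w * G t%:C - t%:C * G t%:C))).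
    have [M M0 hM] := disc_algebra_bounded w0 A1.
    apply: (@integrable_poissonM _ _ w0 _ M) => // t.
    by rewrite (le_trans (Im_le_normc _))// hM.
  have I2 : mu.-integrable setT (EFin \o (fun t : R => poisson w t * Im ('i * G t%:C))).
    have [M M0 hM] := disc_algebra_bounded w0 A2.
    apply: (@integrable_poissonM _ _ w0 _ M) => // t.
    by rewrite (le_trans (Im_le_normc _))// hM.
  rewrite (@eq_Rintegral _ _ _ mu setT (fun t : R =>
    (pi^-1 * (poisson w t * Im ('i * G t%:C))) -
    (pi * v)^-1 * (poisson w t * Im (w * G t%:C - t%:C * G t%:C)))); last first.
    have aux (a b c d P V : R) : V != 0 -> V^-1 * (d * a) * (- P * b) =
        P * (a * c) - P / V * (a * (d * b + V * c)) by move=> V0; field.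
    move=> t _; rewrite ReV /= pE E1 E2 invfM; apply: aux.
    by rewrite gt_eqF.
  rewrite RintegralB//.
  + by rewrite !RintegralZl// P1 P2 mulr0 subr0 mulKf.
  + by have := integrableZl measurableT pi^-1 I2.
  + by have := integrableZl measurableT (pi * v)^-1 I1.
- rewrite /Rintegral (@integral_density_prob _ pd (fun t => Im ((w - t%:C)^-1)) v^-1); last 2 first.
  + exact: measurable_Im_cauchy_kernel.
  + by move=> t; rewrite (le_trans (Im_le_normc _))// normc_cauchy_kernel.
  rewrite -/(Rintegral mu setT (fun t => Im ((w - t%:C)^-1) * pd t)).
  rewrite (@eq_Rintegral _ _ _ mu setT (fun t : R => pi^-1 * (poisson w t * Im (G t%:C)))); last first.
    by move=> t _; rewrite Im_cauchy_kernel /= pE; ring.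
  have P1 := poisson_formula w0 (G_algebra w0) mImG.
  rewrite RintegralZl//; first by rewrite P1 mulKf.
  have [M M0 hM] := disc_algebra_bounded w0 (G_algebra w0).
  apply: (@integrable_poissonM _ _ w0 _ M) => // t.
  by rewrite (le_trans (Im_le_normc _))// hM.
Qed.

Lemma voiculescu_measure_of_solution :
  exists (F : C -> C) (m : borel_prob R),
  [/\ forall s, 0 <= Im s -> 2 * T + Im s <= Im (F s) /\
        F s + g (F s) = s + 0 +i* (5 / 2 * T),
      forall w, 0 < Im w -> cauchy_transform m w = (F w)^-1,
      symmetric_prob m,
      forall B, measurable B -> m B =
        (\int[mu]_(t in B) (Im (F t%:C) / (pi * normc (F t%:C) ^+ 2))%:E)%E &
      mu.-integrable setT
        (fun t => (Im (F t%:C) / (pi * normc (F t%:C) ^+ 2))%:E)].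
Proof.
exists F, (density_prob pd); split.
- by move=> s s0; split; [exact: F_im|exact: F_eq].
- by move=> w w0; exact: cauchy_pd.
- exact: density_prob_symmetric pN.
- by [].
- exact: (integrable_density pd).
Qed.

End WithSolution.

Hypothesis g_algebra : forall w, 0 < Im w -> forall X, disc_algebra w X ->
  (forall s, 0 <= Im s -> normc (X s) <= T / 2) ->
  disc_algebra w (fun s => g (s + 0 +i* (5 / 2 * T) - X s)).

Theorem voiculescu_measure :
  exists (F : C -> C) (m : borel_prob R),
  [/\ forall s, 0 <= Im s -> 2 * T + Im s <= Im (F s) /\
        F s + g (F s) = s + 0 +i* (5 / 2 * T),
      forall w, 0 < Im w -> cauchy_transform m w = (F w)^-1,
      symmetric_prob m,
      forall B, measurable B -> m B =
        (\int[mu]_(t in B) (Im (F t%:C) / (pi * normc (F t%:C) ^+ 2))%:E)%E &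
      mu.-integrable setT
        (fun t => (Im (F t%:C) / (pi * normc (F t%:C) ^+ 2))%:E)].
Proof.
have [X [XP XA]] := picard_limit T_gt0 g_bound g_lip g_algebra.
by apply: (@voiculescu_measure_of_solution X) => // s s0; have [] := XP s s0.
Qed.

End ConstructionMeasure.

(** * The family [-T/z] and its truncations *)

Section Families.
Variable R : realType.
Local Notation C := R[i].
Local Notation mu := (@lebesgue_measure R).
Local Notation Re := (@complex.Re R).
Local Notation Im := (@complex.Im R).

(* The law [m] has Voiculescu transform [g - i 5T/2]; [F] is its reciprocal
   Cauchy transform, extended to the real line. *)
Definition law_of (T : R) (g : C -> C) (F : C -> C) (m : borel_prob R) :=
  [/\ forall s, 0 <= Im s -> 2 * T + Im s <= Im (F s) /\
        F s + g (F s) = s + 0 +i* (5 / 2 * T),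
      forall w, 0 < Im w -> cauchy_transform m w = (F w)^-1,
      symmetric_prob m,
      forall B, measurable B -> m B =
        (\int[mu]_(t in B) (Im (F t%:C) / (pi * normc (F t%:C) ^+ 2))%:E)%E &
      mu.-integrable setT
        (fun t => (Im (F t%:C) / (pi * normc (F t%:C) ^+ 2))%:E)].

Definition neginv (T : R) (z : C) : C := - (T%:C / z).

(** On [Im z >= 2T] the modulus of [T / z] can reach [1/2], which is at most [T / 2] exactly when
    [T >= 1]. *)
Lemma neginv_bound T : 1 <= T -> forall z, 2 * T <= Im z -> normc (neginv T z) <= T / 2.
Proof.
move=> T1 z zT; have T0 : 0 < T by rewrite (lt_le_trans ltr01).
have nz : 2 * T <= normc z.
  by rewrite (le_trans zT)// (le_trans _ (Im_le_normc z))// ler_norm.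
have nz0 : 0 < normc z by rewrite (lt_le_trans _ nz)// mulr_gt0.
by rewrite /neginv normc_opp normcM normcV normc_real gtr0_norm// ler_pM2l//
  lef_pV2 ?posrE//; nra.
Qed.

Lemma neginv_lip T : 1 <= T -> forall z1 z2, 2 * T <= Im z1 -> 2 * T <= Im z2 ->
  normc (neginv T z1 - neginv T z2) <= normc (z1 - z2) / 4.
Proof.
move=> T1 z1 z2 h1 h2; have T0 : 0 < T by rewrite (lt_le_trans ltr01).
have nz z : 2 * T <= Im z -> 2 * T <= normc z.
  by move=> h; rewrite (le_trans h)// (le_trans _ (Im_le_normc z))// ler_norm.
have z0 z : 2 * T <= Im z -> z != 0.
  by move=> h; apply: Im_gt0_neq0; rewrite (lt_le_trans _ h)// mulr_gt0.
have -> : neginv T z1 - neginv T z2 = T%:C * (z1 - z2) / (z1 * z2).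
  by rewrite /neginv; field; rewrite !z0.
rewrite !normcM normcV normcM normc_real gtr0_norm// mulrAC mulrC.
rewrite ler_wpM2l ?normc_ge0// ler_pdivrMr; last first.
  by rewrite mulr_gt0// normc_gt0 z0.
have := ler_pM (ltW (mulr_gt0 (ltr0n R 2) T0)) (ltW (mulr_gt0 (ltr0n R 2) T0)) (nz _ h1) (nz _ h2).
nra.
Qed.

Lemma neginv_sym T (z : C) : neginv T (- conjc z) = - conjc (neginv T z).
Proof.
by rewrite /neginv conjc_N opprK invrN mulrN opprK conjc_M conjc_inv conjc_real.
Qed.

Lemma neginv_algebra T : 0 < T -> forall w, 0 < Im w -> forall X, disc_algebra w X ->
  (forall s, 0 <= Im s -> normc (X s) <= T / 2) ->
  disc_algebra w (fun s => neginv T (s + 0 +i* (5 / 2 * T) - X s)).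
Proof.
move=> T0 w w0 X XA XT; apply: (disc_algebraN w0).
apply: (disc_algebraM w0); first exact: disc_algebra_cst.
by apply: (disc_algebra_inv w0 _ _ XA XT); [rewrite mulr_gt0|lra].
Qed.

Lemma law_neginv T : 1 <= T -> exists F m, law_of T (neginv T) F m.
Proof.
move=> T1; have T0 : 0 < T by rewrite (lt_le_trans ltr01).
apply: (voiculescu_measure T0 (neginv_bound T1) (neginv_lip T1)).
- by move=> z _; exact: neginv_sym.
- exact: neginv_algebra.
Qed.

Definition resolvent (l : R) (z : C) : C := (z + 0 +i* l)^-1.

(* [neginv_trunc N T z = - T (1 - (il / (z + il)) ^+ N) / z] with [l = 2 N]. *)
Definition neginv_trunc (N : nat) (T : R) (z : C) : C :=
  - (T%:C * \sum_(j < N) (0 +i* (2 * N%:R)) ^+ j * resolvent (2 * N%:R) z ^+ j.+1).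

Section Truncation.
Variable N : nat.
Hypothesis N_gt0 : (0 < N)%N.
Let l : R := 2 * N%:R.
Let l_gt0 : 0 < l.
Proof. by rewrite mulr_gt0// ltr0n. Qed.

Let resolvent_bound b z : 0 <= b -> b <= Im z -> normc (resolvent l z) <= (l + b)^-1.
Proof.
move=> b0 bz; have lb : 0 < l + b by rewrite ltr_wpDr.
have h : l + b <= normc (z + 0 +i* l).
  rewrite (le_trans _ (Im_le_normc _))// (le_trans _ (ler_norm _))// cReImE /=.
  by rewrite addrC lerD2r.
by rewrite normcV lef_pV2 ?posrE ?(lt_le_trans lb).
Qed.

(** Each of the [N] terms is at most [l ^+ j / l ^+ j.+1 = 1 / l], and [N / l = 1/2]. No lower bound
    on [T] enters. *)
Lemma neginv_trunc_bound T : 0 < T ->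
  forall z, 2 * T <= Im z -> normc (neginv_trunc N T z) <= T / 2.
Proof.
move=> T0 z zT; rewrite /neginv_trunc normc_opp normcM normc_real gtr0_norm// ler_pM2l//.
have z0 : 0 <= Im z by rewrite (le_trans _ zT)// mulr_ge0// ltW.
have rl : normc (resolvent l z) <= l^-1 by have := resolvent_bound (lexx 0) z0; rewrite addr0.
rewrite -/l; apply: (@le_trans _ _ (\sum_(j < N) l^-1)); last first.
  rewrite sumr_const card_ord -[leLHS]mulr_natl /l; have : N%:R != 0 :> R by rewrite pnatr_eq0 -lt0n.
  by move=> N0; rewrite invfM mulrCA divff// mulr1.
elim/big_rec2: _ => [|j x y _ IH]; first by rewrite normc0.
rewrite (le_trans (ler_normcD _ _))// lerD// normcM !normcX normc_imag gtr0_norm//.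
rewrite exprS mulrCA mulrC -exprMn; apply: (le_trans _ rl).
rewrite ler_piMl ?normc_ge0//.
apply: exprn_ile1; first by rewrite mulr_ge0 ?normc_ge0// ltW.
by rewrite -(mulfV (lt0r_neq0 l_gt0)) ler_wpM2l// ltW.
Qed.

Let normc_subX (r : R) (a b : C) j : normc a <= r -> normc b <= r ->
  normc (a ^+ j.+1 - b ^+ j.+1) <= j.+1%:R * r ^+ j * normc (a - b).
Proof.
move=> ar br; have r0 : 0 <= r by rewrite (le_trans _ ar)// normc_ge0.
elim: j => [|j IH]; first by rewrite expr0 !mul1r !expr1.
have -> : a ^+ j.+2 - b ^+ j.+2 = a * (a ^+ j.+1 - b ^+ j.+1) + (a - b) * b ^+ j.+1.
  by rewrite !exprS; ring.
rewrite (le_trans (ler_normcD _ _))// !normcM normcX -[j.+2]addn1 natrD !mulrDl mul1r.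
apply: lerD; last first.
  rewrite mulrC ler_wpM2r ?normc_ge0// lerXn2r ?nnegrE ?normc_ge0//.
apply: (@le_trans _ _ (r * (j.+1%:R * r ^+ j * normc (a - b)))).
  by rewrite ler_pM ?normc_ge0.
by rewrite exprS le_eqVlt; apply/orP; left; apply/eqP; ring.
Qed.

(** A crude bound, good even when [r] is close to 1; it handles [T < 1]. *)
Let sum_bound1 (r : R) : 0 <= r -> r <= 1 ->
  \sum_(j < N) j.+1%:R * r ^+ j <= N%:R ^+ 2.
Proof.
move=> r0 r1; rewrite expr2 -natrM -[X in (_ * X)%N]card_ord.
rewrite natrM mulr_natr -sumr_const; apply: ler_sum => j _.
rewrite -[leRHS]mulr1 ler_pM ?exprn_ge0 ?exprn_ile1// ler_nat.
exact: ltn_ord.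
Qed.

(** Closed form of a differentiated geometric sum; it handles [T >= 1], with [r] bounded away from
    1. *)
Let sum_bound2 (r : R) : 0 <= r -> r <= 1 ->
  (\sum_(j < N) j.+1%:R * r ^+ j) * (1 - r) ^+ 2 <= 1.
Proof.
move=> r0 r1.
have -> : (\sum_(j < N) j.+1%:R * r ^+ j) * (1 - r) ^+ 2 =
    1 - r ^+ N - N%:R * r ^+ N * (1 - r).
  elim: N => [|k IH]; first by rewrite big_ord0 mul0r expr0 mul0r mul0r; ring.
  rewrite big_ord_recr /= mulrDl IH [r ^+ k.+1]exprS -[k.+1%:R]natr1.
  by move: (r ^+ k) (k%:R : R) => P K; ring.
have h1 : 0 <= r ^+ N by rewrite exprn_ge0.
have h2 : 0 <= N%:R * r ^+ N * (1 - r) by rewrite !mulr_ge0// subr_ge0.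
lra.
Qed.

Lemma neginv_trunc_lip T : 0 < T -> forall z1 z2, 2 * T <= Im z1 -> 2 * T <= Im z2 ->
  normc (neginv_trunc N T z1 - neginv_trunc N T z2) <= normc (z1 - z2) / 4.
Proof.
move=> T0 z1 z2 h1 h2; pose r := (l + 2 * T)^-1.
have T20 : 0 <= 2 * T by rewrite mulr_ge0// ltW.
have lT : 0 < l + 2 * T by rewrite ltr_wpDr.
have r0 : 0 < r by rewrite invr_gt0.
have R1 := resolvent_bound T20 h1; have R2 := resolvent_bound T20 h2.
have nz z : 2 * T <= Im z -> z + 0 +i* l != 0.
  by move=> h; apply: Im_gt0_neq0; rewrite cReImE /= ltr_wpDl// (le_trans T20).
have dres : normc (resolvent l z1 - resolvent l z2) <= r ^+ 2 * normc (z1 - z2).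
  have -> : resolvent l z1 - resolvent l z2 = resolvent l z1 * resolvent l z2 * - (z1 - z2).
    by rewrite /resolvent; field; rewrite !nz.
  rewrite !normcM normc_opp ler_wpM2r ?normc_ge0//.
  by rewrite expr2 ler_pM ?normc_ge0.
pose S := \sum_(j < N) j.+1%:R * (l * r) ^+ j.
have D : normc (neginv_trunc N T z1 - neginv_trunc N T z2) <= T * (S * (r ^+ 2 * normc (z1 - z2))).
  have -> : neginv_trunc N T z1 - neginv_trunc N T z2 = T%:C *
      (\sum_(j < N) (0 +i* l) ^+ j * resolvent l z2 ^+ j.+1 -
       \sum_(j < N) (0 +i* l) ^+ j * resolvent l z1 ^+ j.+1) by rewrite /neginv_trunc; ring.
  rewrite normcM normc_real gtr0_norm// ler_pM2l//.
  rewrite -sumrB /S mulr_suml.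
  elim/big_rec2: _ => [|j x y _ IH]; first by rewrite normc0.
  rewrite (le_trans (ler_normcD _ _))// lerD// -mulrBr normcM normcX normc_imag.
  rewrite gtr0_norm// (exprMn _ l r).
  apply: (@le_trans _ _ (l ^+ j * (j.+1%:R * r ^+ j * (r ^+ 2 * normc (z1 - z2))))).
    apply: ler_wpM2l; first by rewrite exprn_ge0// ltW.
    rewrite (le_trans (normc_subX j R2 R1))// normc_distC -/r ler_wpM2l//.
    by rewrite mulr_ge0// exprn_ge0// ltW.
  by rewrite le_eqVlt; apply/orP; left; apply/eqP; ring.
rewrite (le_trans D)// [leRHS]mulrC !mulrA ler_wpM2r ?normc_ge0//.
have lr0 : 0 <= l * r by rewrite mulr_ge0// ltW.
have e1 : 1 - l * r = 2 * T * r.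
  have : (l + 2 * T) * r = 1 by rewrite mulfV// gt_eqF.
  by rewrite mulrDl; lra.
have lr1 : l * r <= 1 by rewrite -subr_ge0 e1 mulr_ge0// ltW.
have S1 := sum_bound1 lr0 lr1; have S2 := sum_bound2 lr0 lr1.
rewrite -/S e1 in S1 S2 *.
have S0 : 0 <= S by apply: sumr_ge0 => j _; rewrite mulr_ge0// exprn_ge0.
have r20 : 0 <= r ^+ 2 by rewrite exprn_ge0// ltW.
have Sr : 0 <= S * r ^+ 2 by rewrite mulr_ge0.
(* For [T >= 1], [1 - l r = 2 T r] turns the second bound into [T ^+ 2 * S * r ^+ 2 <= 1/4]. For
   [T < 1], [l r <= 1] means [N r <= 1/2], and the first bound gives [S * r ^+ 2 <= 1/4]. *)
have [T1|T1] := leP 1 T.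
  have : T * S * r ^+ 2 <= T ^+ 2 * (S * r ^+ 2).
    by rewrite -mulrA ler_wpM2r// expr2 ler_pMl.
  have e2 : S * (2 * T * r) ^+ 2 = 4 * (T ^+ 2 * (S * r ^+ 2)) by ring.
  rewrite e2 in S2; lra.
have h : T * S * r ^+ 2 <= S * r ^+ 2.
  by rewrite -mulrA -[leRHS]mul1r ler_wpM2r// ltW.
have lrN : N%:R * r * 2 <= 1 by rewrite (le_trans _ lr1)// /l mulrC mulrA.
have h3 : S * r ^+ 2 <= (N%:R * r) ^+ 2 by rewrite exprMn ler_wpM2r.
have Nr0 : 0 <= N%:R * r by rewrite mulr_ge0// ltW.
nra.
Qed.

(** Reflection negates both [il] and the resolvent; the [j]-th term contains [2j + 1] such factors,
    so its sign changes. *)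
Lemma neginv_trunc_sym T (z : C) :
  neginv_trunc N T (- conjc z) = - conjc (neginv_trunc N T z).
Proof.
rewrite /neginv_trunc conjc_N opprK conjc_M conjc_real conjc_sum -mulrN -sumrN.
congr (_ * _).
apply: eq_bigr => j _; rewrite conjc_M !conjc_X.
have -> : resolvent (2 * N%:R) (- conjc z) = - conjc (resolvent (2 * N%:R) z).
  rewrite /resolvent conjc_inv -invrN; congr (_^-1).
  by apply: complex_eqP; rewrite !cReImE; case: (z) => a b /=; ring.
have -> : conjc (0 +i* (2 * N%:R)) = - (0 +i* (2 * N%:R)) :> C.
  by apply: complex_eqP; rewrite /= ?oppr0.
by rewrite [in LHS]exprNn [in RHS]exprNn exprS; ring.
Qed.

Lemma neginv_trunc_algebra T : 0 < T -> forall w, 0 < Im w ->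
  forall X, disc_algebra w X ->
  (forall s, 0 <= Im s -> normc (X s) <= T / 2) ->
  disc_algebra w (fun s => neginv_trunc N T (s + 0 +i* (5 / 2 * T) - X s)).
Proof.
move=> T0 w w0 X XA XT; apply: (disc_algebraN w0).
apply: (disc_algebraM w0); first exact: disc_algebra_cst.
have Rr : disc_algebra w (fun s => resolvent l (s + 0 +i* (5 / 2 * T) - X s)).
  have := @disc_algebra_inv _ w w0 X (5 / 2 * T + l) (T / 2) _ _ XA XT.
  move=> H; apply: (disc_algebra_ext (H _ _)); [|by have := l_gt0; lra|].
    by rewrite addr_gt0// mulr_gt0.
  move=> s _; rewrite /resolvent; congr (_^-1).
  have -> : 0 +i* (5 / 2 * T + l) = 0 +i* (5 / 2 * T) + 0 +i* l :> C.
    by apply: complex_eqP; rewrite !cReImE /= ?addr0.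
  by ring.
apply: (@disc_algebra_sum _ w (fun j s => (0 +i* (2 * N%:R)) ^+ j *
  resolvent (2 * N%:R) (s + 0 +i* (5 / 2 * T) - X s) ^+ j.+1)) => j.
apply: (disc_algebraM w0); first exact: disc_algebra_cst.
exact: (disc_algebraX w0).
Qed.

Lemma law_neginv_trunc T : 0 < T -> exists F m, law_of T (neginv_trunc N T) F m.
Proof.
move=> T0.
apply: (voiculescu_measure T0 (neginv_trunc_bound T0) (neginv_trunc_lip T0)).
- by move=> z _; exact: neginv_trunc_sym.
- exact: neginv_trunc_algebra.
Qed.

(** The sum is geometric with ratio [il / (z + il)], and [1] minus this ratio is [z / (z + il)]. *)
Lemma neginv_sub_neginv_trunc T z : 0 < Im z ->
  neginv T z - neginv_trunc N T z = - (T%:C * (0 +i* l * resolvent l z) ^+ N / z).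
Proof.
move=> z0; have zn : z != 0 by exact: Im_gt0_neq0.
have zl : z + 0 +i* l != 0 by apply: Im_gt0_neq0; rewrite cReImE /= addr_gt0.
apply: (mulIf zn); rewrite /neginv /neginv_trunc -/l opprK mulrDl !mulNr !divfK//.
have -> : T%:C * (\sum_(j < N) (0 +i* l) ^+ j * resolvent l z ^+ j.+1) * z =
    T%:C * - (((0 +i* l * resolvent l z) - 1) * \sum_(j < N) (0 +i* l * resolvent l z) ^+ j).
  rewrite -mulrA; congr (_ * _); rewrite -mulNr mulr_suml mulr_sumr.
  apply: eq_bigr => j _; have -> : - (0 +i* l * resolvent l z - 1) = resolvent l z * z.
    by rewrite /resolvent; field.
  by rewrite exprMn exprSr; ring.
by rewrite -subrX1; ring.
Qed.

Lemma neginv_sub_neginv_trunc_bound z : 2 * N%:R <= Im z ->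
  normc (neginv N%:R z - neginv_trunc N N%:R z) <= 2^-1 ^+ N / 2.
Proof.
move=> zN; have N0 : 0 < N%:R :> R by rewrite ltr0n.
have z0 : 0 < Im z by rewrite (lt_le_trans _ zN)// mulr_gt0.
rewrite neginv_sub_neginv_trunc// normc_opp !normcM normcV normcX normcM normc_imag normc_real.
rewrite !gtr0_norm//.
have h1 : l * normc (resolvent l z) <= 2^-1.
  have := resolvent_bound (ltW l_gt0) zN; rewrite -(ler_pM2l l_gt0) => /le_trans; apply.
  by rewrite ler_pdivrMr ?addr_gt0//; lra.
have h2 : N%:R / normc z <= 2^-1.
  have nz : 2 * N%:R <= normc z.
    by rewrite (le_trans zN)// (le_trans _ (Im_le_normc z))// ler_norm.
  by rewrite ler_pdivrMr; [lra|rewrite (lt_le_trans _ nz)// mulr_gt0].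
rewrite mulrAC mulrC; have h0 : 0 <= l * normc (resolvent l z).
  by rewrite mulr_ge0 ?normc_ge0// ltW.
apply: ler_pM => //; first exact: exprn_ge0.
  by rewrite divr_ge0 ?normc_ge0.
by rewrite lerXn2r ?nnegrE.
Qed.

End Truncation.
End Families.

(** * Free powers and Kolmogorov distance *)

Section FreePowers.
Variable R : realType.
Local Notation C := R[i].
Local Notation mu := (@lebesgue_measure R).
Local Notation Re := (@complex.Re R).
Local Notation Im := (@complex.Im R).
Implicit Types (T : R) (g F : C -> C) (m : borel_prob R).

Lemma law_of_recip T g F m : law_of T g F m ->
  forall w, 0 < Im w -> recip_cauchy m w = F w.
Proof. by move=> [_ mF _ _ _] w w0; rewrite /recip_cauchy mF// invrK. Qed.

Lemma law_of_voiculescu T g F m : 0 < T ->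
  (forall z, 2 * T <= Im z -> normc (g z) <= T / 2) ->
  (forall z1 z2, 2 * T <= Im z1 -> 2 * T <= Im z2 ->
     normc (g z1 - g z2) <= normc (z1 - z2) / 4) ->
  law_of T g F m -> forall beta, 7 * T + 1 <= beta ->
  is_voiculescu_transform m (truncated_cone 1 beta)
    (fun z => g z - 0 +i* (5 / 2 * T)).
Proof.
move=> T0 gb gl mF beta hb; have mR := law_of_recip mF.
have [FE _ _ _ _] := mF.
(* Adding the transform lowers the imaginary part by at most [3T] and moves the real part by at most
   [T/2]; [Im z > 7T + 1] then keeps the image above height 1 and inside aperture 2. *)
exists 2, 1; split => //.
  move=> w1 w2; rewrite !inE => -[/= h1 _] [/= h2 _].
  have w10 : 0 < Im w1 by rewrite (lt_trans ltr01).
  have w20 : 0 < Im w2 by rewrite (lt_trans ltr01).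
  rewrite !mR// => e; have [_ e1] := FE _ (ltW w10); have [_ e2] := FE _ (ltW w20).
  by move: e1; rewrite e e2 => /addIr.
move=> z [/= h1 h2]; have zT : 2 * T <= Im z by lra.
have := le_trans (Im_le_normc _) (gb _ zT); rewrite ler_norml => /andP[i1 i2].
have := le_trans (Re_le_normc _) (gb _ zT); rewrite ler_norml => /andP[r1 r2].
have w1 : 1 < Im (z + (g z - 0 +i* (5 / 2 * T))) by rewrite !cReImE /=; lra.
split.
  split => //=; move: h2; rewrite mul1r !ltr_norml !cReImE /= => /andP[h2 h3].
  by apply/andP; split; lra.
have w0 : 0 < Im (z + (g z - 0 +i* (5 / 2 * T))) by rewrite (lt_trans ltr01).
rewrite mR//; have [f1 f2] := FE _ (ltW w0).
apply: (voiculescu_inj gl) => //; first by rewrite (le_trans _ f1)// lerDl ltW.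
by rewrite f2; ring.
Qed.

(** Index [n] carries the power [n + 1]. All transforms are available on cones of aperture 1, so the
    three needed for one convolution share a sufficiently high cone. *)
Lemma free_power_family (m : nat -> borel_prob R) (phi : nat -> C -> C) :
  (forall n, exists b, forall beta, b <= beta ->
     is_voiculescu_transform (m n) (truncated_cone 1 beta) (phi n)) ->
  (forall n z, phi n.+1 z = phi n z + phi 0%N z) ->
  forall n, is_free_power (m 0%N) n.+1 (m n).
Proof.
move=> H phiS; elim=> [|n IH]; first exact: is_free_power1.
apply: is_free_powerS IH _.
have [b0 h0] := H 0%N; have [b1 h1] := H n; have [b2 h2] := H n.+1.
pose b := Num.max (Num.max b0 b1) (Num.max b2 1).
exists 1, b, (phi n), (phi 0%N); split => //.
- by rewrite /b !lt_max ltr01 !orbT.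
- by apply: h1; rewrite /b !le_max lexx !orbT.
- by apply: h0; rewrite /b !le_max lexx.
- rewrite (_ : (fun z => phi n z + phi 0%N z) = phi n.+1); last first.
    by apply/funext => z; rewrite phiS.
  by apply: h2; rewrite /b !le_max lexx !orbT.
Qed.

Lemma is_free_power_neginv : exists m : nat -> borel_prob R,
  (forall n, exists F, law_of n.+1%:R (neginv n.+1%:R) F (m n)) /\
  forall n, is_free_power (m 0%N) n.+1 (m n).
Proof.
have H n : exists m : borel_prob R, exists F, law_of n.+1%:R (neginv n.+1%:R) F m.
  by have [|F [m mF]] := @law_neginv R n.+1%:R; [rewrite ler1n|exists m, F].
have [m mP] := choice H; exists m; split => //.
apply: (free_power_family
  (phi := fun n z => neginv n.+1%:R z - 0 +i* (5 / 2 * n.+1%:R))) => n.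
  have [F mF] := mP n; exists (7 * n.+1%:R + 1) => beta hb.
  apply: (law_of_voiculescu _ _ _ mF) => //.
  - by apply: neginv_bound; rewrite ler1n.
  - by apply: neginv_lip; rewrite ler1n.
move=> z; have -> : 0 +i* (5 / 2 * n.+2%:R) =
    0 +i* (5 / 2 * n.+1%:R) + 0 +i* (5 / 2 * 1%:R) :> C.
  by apply: complex_eqP; rewrite !cReImE /= ?addr0// -[n.+2%:R]natr1; ring.
rewrite /neginv -[n.+2%:R]natr1 (raddfD (real_complex R)).
by rewrite mulrDl !opprD addrACA.
Qed.

Lemma free_infinitely_divisible_neginv_trunc N : (0 < N)%N ->
  exists F m, law_of N%:R (neginv_trunc N N%:R) F m /\ free_infinitely_divisible m.
Proof.
move=> N0; have NR : 0 < N%:R :> R by rewrite ltr0n.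
(* The Dirac mass is a placeholder for [T <= 0], so that a law can be chosen for every real [T]. *)
have H T : exists m : borel_prob R, exists F, 0 < T -> law_of T (neginv_trunc N T) F m.
  have [T0|T0] := boolP (0 < T).
    by have [F [m mF]] := law_neginv_trunc N0 T0; exists m, F.
  by exists (dirac (0%R : measurableTypeR R)), id.
have [m mP] := choice H; have [F mF] := mP N%:R.
exists F, (m N%:R); split; first exact: mF.
move=> k k0; have kR : 0 < k%:R :> R by rewrite ltr0n.
(* The k-th root sits at parameter [N / k]; its power [j + 1] sits at [T j], and [T k.-1 = N]. *)
pose T j : R := j.+1%:R * (N%:R / k%:R).
have T0 j : 0 < T j by rewrite mulr_gt0// divr_gt0.
exists (m (T 0%N)); rewrite -(prednK k0).
have -> : m N%:R = m (T k.-1).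
  by rewrite /T (prednK k0) mulrC divfK// gt_eqF.
apply: (@free_power_family (m \o T)
  (fun j z => neginv_trunc N (T j) z - 0 +i* (5 / 2 * T j))) => j.
  have [G /(_ (T0 j)) mG] := mP (T j); exists (7 * T j + 1) => beta hb.
  apply: (law_of_voiculescu _ _ _ mG) => //; first exact: neginv_trunc_bound.
  exact: neginv_trunc_lip.
move=> z; have TS : T j.+1 = T j + T 0%N by rewrite /T -[j.+2%:R]natr1; ring.
have -> : 0 +i* (5 / 2 * T j.+1) = 0 +i* (5 / 2 * T j) + 0 +i* (5 / 2 * T 0%N) :> C.
  by apply: complex_eqP; rewrite !cReImE /= ?addr0// TS; ring.
by rewrite /neginv_trunc TS (raddfD (real_complex R)) mulrDl !opprD addrACA.
Qed.

(** The densities differ by at most [K / (pi (1 + t ^+ 2))], whose integral over the line is [K]. *)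
Lemma kolmogorov_dist_law T T' g g' F F' m m' (K : R) :
  law_of T g F m -> law_of T' g' F' m' ->
  (forall t : R, normc ((F t%:C)^-1 - (F' t%:C)^-1) <= K / (1 + t ^+ 2)) ->
  kolmogorov_dist m m' <= K.
Proof.
move=> [_ _ _ mE mi] [_ _ _ mE' mi'] FK.
pose p t := Im (F t%:C) / (pi * normc (F t%:C) ^+ 2).
pose p' t := Im (F' t%:C) / (pi * normc (F' t%:C) ^+ 2).
have pi0 := pi_gt0 R.
have i0 : 0 < Im ('i : C) by exact: ltr01.
have hE : poisson 'i = fun t : R => (1 + t ^+ 2)^-1.
  by apply/funext => t; rewrite /poisson /= subr0 expr1n addrC mul1r.
have hi : mu.-integrable setT (fun t : R => (K / pi * poisson 'i t)%:E).
  have := integrableZl measurableT (K / pi) (@integrable_oneDsqrV R).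
  by rewrite hE.
have hK : \int[mu]_t (K / pi * poisson 'i t) = K.
  rewrite RintegralZl//; last by rewrite hE; exact: integrable_oneDsqrV.
  by rewrite Rintegral_poisson// divfK// gt_eqF.
have pp t : `|p t - p' t| <= K / pi * poisson 'i t.
  have -> : p t - p' t = - pi^-1 * Im ((F t%:C)^-1 - (F' t%:C)^-1).
    by rewrite cImD cImN !cImV /p /p' !invfM; ring.
  rewrite normrM normrN (gtr0_norm (x := pi^-1)) ?invr_gt0//.
  rewrite (_ : K / pi * _ = pi^-1 * (K * poisson 'i t)); last by ring.
  rewrite ler_pM2l ?invr_gt0//.
  by rewrite hE (le_trans (Im_le_normc _)).
apply: ge_sup; first by exists `|fine (m [set t | t < 0]) - fine (m' [set t | t < 0])|, 0.
move=> _ [x _ <-].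
have mS : measurable ([set t | t < x] : set (measurableTypeR R)).
  by rewrite -set_itvNyo; exact: measurable_itv.
rewrite mE// mE'// -/(Rintegral mu [set t | t < x] p) -/(Rintegral mu [set t | t < x] p').
have ip : mu.-integrable [set t | t < x] (EFin \o p) by exact: integrableS mi.
have ip' : mu.-integrable [set t | t < x] (EFin \o p') by exact: integrableS mi'.
have id : mu.-integrable [set t | t < x] (EFin \o (fun t => p t - p' t)).
  by have := integrableB mS ip ip'.
rewrite -RintegralB// (le_trans (le_normr_Rintegral mS id))//.
apply: (@le_trans _ _ (\int[mu]_(t in [set t | t < x]) (K / pi * poisson 'i t))).
  apply: le_Rintegral => //; first by have := integrable_abse id.
  exact: integrableS hi.
rewrite -[leRHS]hK /Rintegral fine_le//.
- by apply: integrable_fin_num => //; exact: integrableS hi.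
- exact: integrable_fin_num.
apply: ge0_subset_integral => //.
- exact: (measurable_int mu).
- by move=> t _; rewrite lee_fin (le_trans _ (pp t)).
Qed.

(** Here [Re F = t - a] with [|a| <= T/2] and [Im F >= 2T]; use
    [(t - a) ^+ 2 >= t ^+ 2 / 2 - a ^+ 2], the loss being covered by [4 T ^+ 2]. *)
Lemma law_of_real_lower T g F m (t : R) : 1 <= T ->
  (forall z, 2 * T <= Im z -> normc (g z) <= T / 2) ->
  law_of T g F m -> (1 + t ^+ 2) / 2 <= normc (F t%:C) ^+ 2.
Proof.
move=> T1 gb [/(_ t%:C (lexx 0))[+ e] _ _ _ _]; rewrite /= addr0 => FT.
have := le_trans (Re_le_normc _) (gb _ FT); rewrite ler_norml => /andP[r1 r2].
have : Re (F t%:C) = t - Re (g (F t%:C)).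
  by have := congr1 Re e; rewrite !cReD /= addr0; lra.
rewrite normc_sqr; set a := Re (g _) in r1 r2 * => ->.
move: FT; set b := Im _ => FT.
have h1 : (2 * T) ^+ 2 <= b ^+ 2 by rewrite lerXn2r ?nnegrE//; lra.
have h2 : 0 <= (T / 2 - a) * (T / 2 + a) by apply: mulr_ge0; lra.
have := sqr_ge0 (t - 2 * a); nra.
Qed.

Lemma kolmogorov_dist_neginv_neginv_trunc N F F' m m' : (0 < N)%N ->
  law_of N%:R (neginv N%:R) F m -> law_of N%:R (neginv_trunc N N%:R) F' m' ->
  kolmogorov_dist m m' <= 4 / 3 * 2^-1 ^+ N.
Proof.
move=> N0 mF mF'; have N1 : 1 <= N%:R :> R by rewrite ler1n.
have NR : 0 < N%:R :> R by rewrite ltr0n.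
apply: (kolmogorov_dist_law mF mF') => t.
have L := law_of_real_lower t N1 (neginv_bound N1) mF.
have L' := law_of_real_lower t N1 (neginv_trunc_bound N0 NR) mF'.
have [/(_ t%:C (lexx 0))[h1 e1] _ _ _ _] := mF.
have [/(_ t%:C (lexx 0))[h2 e2] _ _ _ _] := mF'.
rewrite /= addr0 in h1 h2.
move: h1 h2 e1 e2 L L'; set z1 := F _; set z2 := F' _ => h1 h2 e1 e2 L L'.
(* Both points solve equations with the same right side, so [|z1 - z2| <= |z1 - z2| / 4 + 2^-1 ^+ N
   / 2]. *)
have D : normc (z1 - z2) <= 2 / 3 * 2^-1 ^+ N.
  have e : z1 - z2 = (neginv N%:R z2 - neginv N%:R z1) - (neginv N%:R z2 - neginv_trunc N N%:R z2).
    have -> : z1 - z2 = z1 + neginv N%:R z1 - (z2 + neginv_trunc N N%:R z2) -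
        neginv N%:R z1 + neginv_trunc N N%:R z2 by ring.
    by rewrite e1 e2; ring.
  have := neginv_lip N1 h2 h1; have := neginv_sub_neginv_trunc_bound N0 h2.
  have := normcB (neginv N%:R z2 - neginv N%:R z1) (neginv N%:R z2 - neginv_trunc N N%:R z2).
  rewrite -e (normc_distC z2 z1); set q := 2^-1 ^+ N; lra.
have n1 : 0 < normc z1.
  by rewrite normc_gt0; apply: Im_gt0_neq0; rewrite (lt_le_trans _ h1)// mulr_gt0.
have n2 : 0 < normc z2.
  by rewrite normc_gt0; apply: Im_gt0_neq0; rewrite (lt_le_trans _ h2)// mulr_gt0.
have -> : z1^-1 - z2^-1 = - (z1 - z2) / (z1 * z2).
  by field; rewrite -!normc_gt0 n1 n2.
have t0 : 0 < 1 + t ^+ 2 by rewrite ltr_pwDl// sqr_ge0.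
have P : (1 + t ^+ 2) / 2 <= normc z1 * normc z2.
  have aux (a b c : R) : 0 <= a -> 0 <= b -> 0 <= c -> a <= b ^+ 2 ->
      a <= c ^+ 2 -> a <= b * c.
    move=> a0 b0 c0 ab ac.
    by rewrite -(ler_pXn2r (n := 2)) ?nnegrE ?mulr_ge0// exprMn [a ^+ 2]expr2 ler_pM.
  by apply: aux => //; [rewrite divr_ge0// ltW|exact: ltW|exact: ltW].
rewrite normcM normcV normc_opp normcM ler_pdivrMr ?mulr_gt0//.
rewrite mulrAC ler_pdivlMr//.
have q0 : 0 <= 2^-1 ^+ N :> R by rewrite exprn_ge0.
apply: (@le_trans _ _ (2 / 3 * 2^-1 ^+ N * (1 + t ^+ 2))).
  by rewrite ler_wpM2r// ltW.
have q1 : 0 <= 4 / 3 * 2^-1 ^+ N :> R by rewrite mulr_ge0.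
by have := ler_wpM2l q1 P; lra.
Qed.

End FreePowers.

(** * Uniqueness of Voiculescu transforms *)

Section TransformAtInfinity.
Variable R : realType.
Local Notation C := R[i].
Local Notation Re := (@complex.Re R).
Local Notation Im := (@complex.Im R).
Variable nu : borel_prob R.
Implicit Types (f h : R -> R) (w : C).

Lemma bounded_integrable_prob f (M : R) : measurable_fun setT f ->
  (forall x, `|f x| <= M) -> nu.-integrable setT (EFin \o f).
Proof.
move=> mf fM; apply: measurable_bounded_integrable => //.
  by rewrite -ge0_fin_numE// fin_num_measure.
exists M; split; first exact: num_real.
by move=> x Mx y _ /=; rewrite (le_trans (fM y))// ltW.
Qed.

Lemma Rintegral_prob_cst (c : R) : \int[nu]_t c = c.
Proof.
rewrite Rintegral_cst// /= -[RHS]mulr1; congr (_ * _).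
by rewrite -[RHS]/(fine 1%E); congr fine; exact: probability_setT.
Qed.

Lemma integrable_prob_cst (c : R) : nu.-integrable setT (fun=> c%:E).
Proof. exact: (@bounded_integrable_prob (fun=> c) `|c|). Qed.

Lemma Rintegral_prob_le f h (M N : R) : measurable_fun setT f ->
  measurable_fun setT h -> (forall x, `|f x| <= M) -> (forall x, `|h x| <= N) ->
  (forall x, f x <= h x) -> \int[nu]_t f t <= \int[nu]_t h t.
Proof.
move=> mf mh fM hN fh; apply: le_Rintegral => //.
- exact: bounded_integrable_prob fM.
- exact: bounded_integrable_prob hN.
Qed.

(** A bounded majorant of [|t / (w - t)|] in a cone when [Im w >= c]. Its mean tends to 0 as [c]
    grows, which replaces tightness and any moment assumption. *)
Definition truncated_ratio (M c t : R) : R := Num.min M (`|t| / c).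

Lemma measurable_truncated_ratio M c : measurable_fun setT (truncated_ratio M c).
Proof.
apply: measurable_minr; first exact: measurable_cst.
by apply: measurable_funM => //; exact: normr_measurable.
Qed.

Lemma truncated_ratio_ge0 M c t : 0 <= M -> 0 < c -> 0 <= truncated_ratio M c t.
Proof. by move=> M0 c0; rewrite le_min M0 divr_ge0// ltW. Qed.

Lemma truncated_ratio_bound M c t : 0 <= M -> 0 < c -> `|truncated_ratio M c t| <= M.
Proof.
by move=> M0 c0; rewrite ger0_norm ?truncated_ratio_ge0// ge_min lexx.
Qed.

Lemma Rintegral_truncated_ratio (M e : R) : 0 <= M -> 0 < e ->
  exists n : nat, \int[nu]_t truncated_ratio M n.+1%:R t <= e.
Proof.
move=> M0 e0.
have cv : (fun n => \int[nu]_t (truncated_ratio M n.+1%:R t)%:E)%E @ \oo -->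
    (\int[nu]_t (0 : R)%:E)%E.
  apply: (@dominated_cvg _ _ _ nu setT _ _ _ (fun=> M%:E)) => //.
  - by move=> n; apply/measurable_EFinP; exact: measurable_truncated_ratio.
  - move=> t _; apply: cvg_EFin; first exact: nearW.
    apply: (@squeeze_cvgr _ _ _ _ (fun=> 0) (fun n : nat => `|t| * harmonic n)).
    + by apply: nearW => n /=; rewrite truncated_ratio_ge0//= ge_min lexx orbT.
    + exact: cvg_cst.
    + by rewrite -(mulr0 `|t|); apply: cvgM; [exact: cvg_cst|exact: cvg_harmonic].
  - exact: integrable_prob_cst.
  - by move=> n t _; rewrite lee_fin truncated_ratio_bound.
move: cv; rewrite integral0 => /fine_cvgP[_ /cvgrPdist_le /(_ _ e0)[n _ /(_ n)]].
rewrite /= leqnn => /(_ isT); rewrite sub0r normrN => H; exists n.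
by rewrite (le_trans (ler_norm _)).
Qed.

Lemma Im_cauchy_transform w : 0 < Im w ->
  Im (cauchy_transform nu w) = - \int[nu]_t poisson w t.
Proof.
move=> w0 /=; rewrite -[RHS]mulN1r -RintegralZl//.
  by apply: eq_Rintegral => t _; rewrite Im_cauchy_kernel mulN1r.
apply: (@bounded_integrable_prob _ (Im w)^-1).
  exact: continuous_measurable_fun (continuous_poisson w0).
move=> t; rewrite -normrN -Im_cauchy_kernel.
by rewrite (le_trans (Im_le_normc _))// normc_cauchy_kernel.
Qed.

Lemma cauchy_transform_asymp (alpha e : R) : 0 < alpha -> 0 < e ->
  exists2 Y : R, 0 < Y & forall w, Y <= Im w -> `|Re w| <= alpha * Im w ->
    normc (w * cauchy_transform nu w - 1) <= e.
Proof.
move=> a0 e0; have M0 : 0 <= 2 + alpha by rewrite addr_ge0// ltW.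
have e20 : 0 < e / 2 by rewrite divr_gt0.
have [n nP] := Rintegral_truncated_ratio M0 e20.
exists n.+1%:R => // w Yw aw; have w0 : 0 < Im w by rewrite (lt_le_trans _ Yw).
pose c (t : R) : C := (w - t%:C)^-1.
have wt t : w - t%:C != 0 by apply: Im_gt0_neq0; rewrite !cReImE /= subr0.
have cE t : w * c t - 1 = t%:C * c t.
  by apply: (mulIf (wt t)); rewrite mulrBl -!mulrA mulVf//; ring.
(* The bound [2 + alpha] comes from [|t| <= |w| + |w - t|] and [|w| <= (1 + alpha) Im w], with
   [Im w <= |w - t|]. *)
have kb t : normc (w * c t - 1) <= truncated_ratio (2 + alpha) n.+1%:R t.
  have D := Im_le_dist w0 t.
  have D0 : 0 < normc (w - t%:C) by rewrite (lt_le_trans w0).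
  rewrite cE normcM normc_real normcV le_min; apply/andP; split; last first.
    by rewrite ler_wpM2l// lef_pV2 ?posrE// (le_trans Yw).
  rewrite ler_pdivrMr// -normc_real.
  have := normcB w (w - t%:C); have := normc_le_ReIm w.
  rewrite subKr (gtr0_norm w0) => h1 h2.
  have h3 : alpha * Im w <= alpha * normc (w - t%:C) by rewrite ler_pM2l.
  lra.
have mr : measurable_fun setT (fun t => Re (c t)) := measurable_Re_cauchy_kernel w0.
have mi : measurable_fun setT (fun t => Im (c t)) := measurable_Im_cauchy_kernel w0.
have br t : `|Re (c t)| <= (Im w)^-1.
  by rewrite (le_trans (Re_le_normc _))// normc_cauchy_kernel.
have bi t : `|Im (c t)| <= (Im w)^-1.
  by rewrite (le_trans (Im_le_normc _))// normc_cauchy_kernel.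
have ir := bounded_integrable_prob mr br; have ii := bounded_integrable_prob mi bi.
have lin (a b d : R) : a * (\int[nu]_t Re (c t)) + b * (\int[nu]_t Im (c t)) + d =
    \int[nu]_t (a * Re (c t) + b * Im (c t) + d).
  have i1 : nu.-integrable setT (EFin \o (fun t => a * Re (c t))).
    by have := integrableZl measurableT a ir.
  have i2 : nu.-integrable setT (EFin \o (fun t => b * Im (c t))).
    by have := integrableZl measurableT b ii.
  have i3 : nu.-integrable setT (EFin \o (fun t => a * Re (c t) + b * Im (c t))).
    by have := integrableD measurableT i1 i2.
  rewrite RintegralD//; last exact: integrable_prob_cst.
  by rewrite Rintegral_prob_cst RintegralD// !RintegralZl.
have bnd (a b d : R) :
    (forall t, `|a * Re (c t) + b * Im (c t) + d| <= normc (w * c t - 1)) ->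
    `|a * (\int[nu]_t Re (c t)) + b * (\int[nu]_t Im (c t)) + d| <= e / 2.
  move=> H; have mk : measurable_fun setT (fun t => a * Re (c t) + b * Im (c t) + d).
    by apply: measurable_funD => //; apply: measurable_funD; apply: measurable_funM.
  have kM t : `|a * Re (c t) + b * Im (c t) + d| <= 2 + alpha.
    by rewrite (le_trans (H t))// (le_trans (kb t))// ge_min lexx.
  rewrite lin (le_trans (le_normr_Rintegral _ (bounded_integrable_prob mk kM)))//.
  apply: le_trans nP; apply: (@Rintegral_prob_le _ _ (2 + alpha) (2 + alpha)).
  - exact: measurableT_comp.
  - exact: measurable_truncated_ratio.
  - by move=> t; rewrite normr_id.
  - by move=> t; exact: truncated_ratio_bound.
  - by move=> t; rewrite (le_trans (H t)).
rewrite (le_trans (normc_le_ReIm _))// (splitr e); apply: lerD.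
- have -> : Re (w * cauchy_transform nu w - 1) =
    Re w * (\int[nu]_t Re (c t)) + - Im w * (\int[nu]_t Im (c t)) + -1.
    by rewrite !cReImE /=; ring.
  apply: bnd => t; rewrite (le_trans _ (Re_le_normc _))// !cReImE /=.
  by rewrite mulNr.
- have -> : Im (w * cauchy_transform nu w - 1) =
    Im w * (\int[nu]_t Re (c t)) + Re w * (\int[nu]_t Im (c t)) + 0.
    by rewrite !cReImE /=; ring.
  apply: bnd => t; rewrite (le_trans _ (Im_le_normc _))// !cReImE /=.
  by rewrite oppr0 !addr0 addrC.
Qed.

(** On a bounded part of the cone the Poisson kernel is bounded below for [t] in a fixed interval,
    and that interval can be chosen to carry enough mass. *)
Lemma cauchy_transform_lower (alpha beta Y : R) : 0 < alpha -> 0 < beta -> 0 < Y ->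
  exists2 K : R, 0 < K & forall w, beta <= Im w <= Y -> `|Re w| <= alpha * Im w ->
    K <= normc (cauchy_transform nu w).
Proof.
move=> a0 b0 Y0.
have h2 : 0 < 2^-1 :> R by rewrite invr_gt0.
have [n nP] := Rintegral_truncated_ratio ler01 h2.
(* For [|t| < n + 1] the denominator of the kernel is at most [M ^+ 2]. *)
pose M := (1 + alpha) * Y + n.+1%:R.
have M0 : 0 < M by rewrite addr_gt0// mulr_gt0// addr_gt0.
exists (beta / M ^+ 2 / 2); first by rewrite divr_gt0// divr_gt0// exprn_gt0.
move=> w /andP[bw wY] aw; have w0 : 0 < Im w by rewrite (lt_le_trans b0).
rewrite (le_trans _ (Im_le_normc _))// Im_cauchy_transform// normrN.
rewrite (le_trans _ (ler_norm _))//.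
pose k := beta / M ^+ 2; have k0 : 0 < k by rewrite divr_gt0// exprn_gt0.
(* This minorant of the kernel is at most [k] and vanishes for [|t| >= n + 1]; its mean is at least
   [k / 2]. *)
apply: (@le_trans _ _ (\int[nu]_t (k - k * truncated_ratio 1 n.+1%:R t))).
  have i1 : nu.-integrable setT (EFin \o truncated_ratio 1 n.+1%:R).
    apply: (@bounded_integrable_prob _ 1); first exact: measurable_truncated_ratio.
    by move=> t; exact: truncated_ratio_bound.
  rewrite RintegralB//.
  - rewrite Rintegral_prob_cst RintegralZl// -/k.
    by have := ler_wpM2l (ltW k0) nP; lra.
  - exact: integrable_prob_cst.
  - by have := integrableZl measurableT k i1.
apply: (@Rintegral_prob_le _ _ (k + k) (Im w)^-1).
- apply: measurable_funB => //; apply: measurable_funM => //.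
  exact: measurable_truncated_ratio.
- exact: continuous_measurable_fun (continuous_poisson w0).
- move=> t; rewrite (le_trans (ler_normB _ _))// (gtr0_norm k0) normrM (gtr0_norm k0) lerD2l.
  by rewrite ler_piMr ?(ltW k0)// truncated_ratio_bound.
- move=> t; rewrite -normrN -Im_cauchy_kernel.
  by rewrite (le_trans (Im_le_normc _))// normc_cauchy_kernel.
move=> t; have [tn|tn] := leP n.+1%:R `|t|.
  have -> : truncated_ratio 1 n.+1%:R t = 1.
    by apply/min_idPl; rewrite ler_pdivlMr// mul1r.
  by rewrite mulr1 subrr ltW// poisson_gt0.
apply: (@le_trans _ _ k).
  by rewrite gerBl mulr_ge0 ?truncated_ratio_ge0// ltW.
have D0 : 0 < (t - Re w) ^+ 2 + Im w ^+ 2 by rewrite ltr_wpDl ?sqr_ge0// exprn_gt0.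
rewrite /k /poisson ler_pM ?invr_ge0 ?(ltW b0) ?(ltW (exprn_gt0 _ M0))//.
rewrite lef_pV2 ?posrE ?(exprn_gt0 _ M0)//.
have h1 : `|t - Re w| <= n.+1%:R + alpha * Y.
  rewrite (le_trans (ler_normB _ _))// lerD//; first exact: ltW.
  by rewrite (le_trans aw)// ler_pM2l.
have h7 : (t - Re w) ^+ 2 <= (n.+1%:R + alpha * Y) ^+ 2.
  rewrite -[leLHS]real_normK ?num_real// lerXn2r ?nnegrE//.
  by rewrite addr_ge0// mulr_ge0// ltW.
have h3 : Im w ^+ 2 <= Y ^+ 2 by rewrite lerXn2r ?nnegrE ?(ltW w0) ?(ltW Y0).
have h4 : 0 <= alpha * Y by rewrite mulr_ge0// ltW.
have h5 : 0 <= n.+1%:R * Y by rewrite mulr_ge0// ltW.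
have h6 : 0 <= alpha * Y * Y by rewrite mulr_ge0// ltW.
rewrite /M; nra.
Qed.

(** For large [y] the point [w] cannot lie low in the cone, where [F] is bounded; high up [F(w)] is
    close to [w], so [w] is nearly vertical and enters any prescribed cone. *)
Lemma recip_cauchy_cone (a1 b1 a2 b2 : R) : 0 < a1 -> 0 < b1 -> 0 < a2 -> 0 < b2 ->
  exists Y : R, forall (y : R) w, Y < y -> truncated_cone a1 b1 w ->
    recip_cauchy nu w = 0 +i* y -> truncated_cone a2 b2 w.
Proof.
(* From [|w - iy| <= e y] with [e <= 1/4], [Im w >= 3y/4], hence [|Re w| < 4 e Im w <= a2 Im w]. *)
move=> a10 b10 a20 b20; pose e := Num.min 1 a2 / 4.
have e0 : 0 < e by rewrite divr_gt0// lt_min ltr01.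
have e1 : e <= 4^-1 by rewrite /e ler_pdivrMr// mulVf// ge_min lexx.
have e2 : 4 * e <= a2 by rewrite /e mulrC divfK// ge_min lexx orbT.
have [Y1 Y10 H1] := cauchy_transform_asymp a10 e0.
pose Y2 := Num.max Y1 b2.
have Y20 : 0 < Y2 by rewrite lt_max Y10.
have [K K0 H2] := cauchy_transform_lower a10 b10 Y20.
exists K^-1 => y w yK [/= bw aw] Fw.
have y0 : 0 < y by rewrite (lt_trans _ yK)// invr_gt0.
have nF : normc (recip_cauchy nu w) = y by rewrite Fw normc_imag gtr0_norm.
have wY : Y2 < Im w.
  rewrite ltNge; apply/negP => wY.
  have := H2 w (introT andP (conj (ltW bw) wY)) (ltW aw).
  rewrite -lef_pV2 ?posrE//; last first.
    have : 0 < normc (recip_cauchy nu w) by rewrite nF.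
    by rewrite /recip_cauchy normcV invr_gt0.
  by rewrite -normcV -/(recip_cauchy nu w) nF leNgt yK.
have := H1 w (le_trans _ (ltW wY)) (ltW aw).
rewrite {1}/Y2 le_max lexx => /(_ isT).
have -> : cauchy_transform nu w = (0 +i* y)^-1 by rewrite -Fw /recip_cauchy invrK.
have iy0 : 0 +i* y != 0 :> C by exact: Im_gt0_neq0.
have -> : w / (0 +i* y) - 1 = (w - 0 +i* y) / (0 +i* y) by field.
rewrite normcM normcV normc_imag gtr0_norm// ler_pdivrMr// => H.
have := le_trans (Re_le_normc _) H; have := le_trans (Im_le_normc _) H.
rewrite !cReImE /= subr0 ler_norml => /andP[h1 _] h2.
have eyy : e * y <= 4^-1 * y by rewrite ler_pM2r.
split => /=; first by rewrite (le_lt_trans _ wY)// le_max lexx orbT.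
have h3 : 4 * e * Im w <= a2 * Im w by rewrite ler_wpM2r// ltW// (lt_trans b10).
rewrite (le_lt_trans h2)// (lt_le_trans _ h3)//; nra.
Qed.

(** The two inverses may come from different cones; high on the imaginary axis both preimages lie in
    the second cone, where [F] is injective. *)
Lemma voiculescu_transform_unique (a1 b1 a2 b2 : R) (phi1 phi2 : C -> C) :
  0 < a1 -> 0 < a2 ->
  is_voiculescu_transform nu (truncated_cone a1 b1) phi1 ->
  is_voiculescu_transform nu (truncated_cone a2 b2) phi2 ->
  exists Y : R, forall y : R, Y < y -> phi1 (0 +i* y) = phi2 (0 +i* y).
Proof.
move=> a10 a20 [c1 [d1 [c10 d10 _ V1]]] [c2 [d2 [c20 d20 inj V2]]].
have [Y HY] := recip_cauchy_cone c10 d10 c20 d20.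
exists (Num.max Y (Num.max 0 (Num.max b1 b2))) => y.
rewrite !gt_max => /and4P[yY y0 yb1 yb2].
have [|u1 u2] := V1 (0 +i* y).
  by split => //=; rewrite normr0 mulr_gt0.
have [|v1 v2] := V2 (0 +i* y).
  by split => //=; rewrite normr0 mulr_gt0.
apply: (@addrI _ (0 +i* y)); apply: inj; rewrite ?inE//.
  exact: HY u2.
by rewrite u2 v2.
Qed.

End TransformAtInfinity.

(** * Failure of infinite divisibility *)

Section PowerSeriesIdentity.
Variable R : realType.
Implicit Types (Q : {poly R}) (q x D : R).

(** Letting [x] tend to 0 kills the constant term, after which one factor [x] cancels. Only negative
    [x] are used, the side on which the quadratic identity will be known. *)
Lemma coef_eq0_of_small Q (k : nat) D :
  (forall x, -1 <= x -> x < 0 -> `|Q.[x]| <= D * `|x| ^+ k) ->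
  forall j, (j < k)%N -> Q`_j = 0.
Proof.
elim: k Q D => [//|k IH] Q D.
elim/poly_ind: Q => [|q c _] H; first by move=> j _; rewrite coef0.
pose M := \sum_(i < size q) `|q`_i|.
have qM x : `|x| <= 1 -> `|q.[x]| <= M.
  move=> x1; rewrite horner_coef (le_trans (ler_norm_sum _ _ _))// /M.
  apply: ler_sum => i _; rewrite normrM normrX ler_piMr//.
  exact: exprn_ile1.
have c0 : c = 0.
  apply/eqP; rewrite -normr_le0.
  have cb x : -1 <= x -> x < 0 -> `|c| <= (`|D| + M) * `|x|.
    move=> x1 x0; have nx : `|x| <= 1 by rewrite ltr0_norm// lerNl.
    have := H x x1 x0; rewrite hornerMXaddC => h.
    have -> : c = (q.[x] * x + c) - q.[x] * x by ring.
    rewrite (le_trans (ler_normB _ _))// mulrDl lerD//.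
      rewrite (le_trans h)// (le_trans (ler_norm _))// normrM normrX normr_id.
      by rewrite ler_wpM2l// exprS ler_piMr// exprn_ile1.
    by rewrite normrM ler_wpM2r// qM.
  apply/ler_addgt0Pr => e e0; rewrite add0r.
  pose K := `|D| + M + 1; have K0 : 0 < K.
    by rewrite ltr_wpDl// addr_ge0// sumr_ge0.
  pose d := Num.min 1 (e / K); have d0 : 0 < d by rewrite lt_min ltr01 divr_gt0.
  have dx : `|- d| = d by rewrite normrN gtr0_norm.
  have := cb (- d); rewrite lerN2 ge_min lexx oppr_lt0 d0 dx => /(_ isT isT) h.
  rewrite (le_trans h)// (@le_trans _ _ (K * d))//.
    by apply: ler_wpM2r; [exact: ltW|rewrite /K lerDl].
  by rewrite mulrC -ler_pdivlMr// ge_min lexx orbT.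
subst c; have q0 := IH q D.
case=> [_|j]; first by rewrite coefD coefMX coefC /= addr0.
rewrite ltnS coefD coefMX coefC /= addr0 => jk; apply: q0 => // x x1 x0.
have := H x x1 x0; rewrite hornerMXaddC addr0 normrM exprSr mulrA.
by rewrite ler_pM2r// normr_gt0 lt_eqF.
Qed.

Lemma horner_bound_of_coef Q (k n : nat) (A x : R) : 0 <= A -> `|x| <= 1 ->
  (size Q <= n)%N -> (forall j, (j < k)%N -> Q`_j = 0) ->
  (forall j, `|Q`_j| <= A) -> `|Q.[x]| <= n%:R * A * `|x| ^+ k.
Proof.
move=> A0 x1 sQ Q0 QA; rewrite (horner_coef_wide _ sQ).
rewrite (le_trans (ler_norm_sum _ _ _))// -mulrA mulr_natl.
rewrite -[X in _ *+ X](card_ord n) -sumr_const; apply: ler_sum => j _.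
rewrite normrM normrX; have [jk|kj] := ltnP j k.
  by rewrite Q0// normr0 mul0r mulr_ge0// exprn_ge0.
rewrite ler_pM ?exprn_ge0//.
by rewrite -(subnK kj) exprD ler_piMl ?exprn_ge0// exprn_ile1.
Qed.

Lemma square_geometric_le0 (x A q : R) : 0 <= q -> q < 1 -> 0 <= A ->
  (forall n : nat, x <= A * n.+1%:R ^+ 2 * q ^+ n) -> x <= 0.
Proof.
(* Chosen so that [q <= s ^+ 3]: two factors [s ^+ n] absorb the square of [n + 1], and the third
   tends to 0. *)
move=> q0 q1 A0 H; pose s := 1 - (1 - q) / 3.
have s0 : 0 < s by rewrite /s; lra.
have s1 : s < 1 by rewrite /s; lra.
have s3 : q <= s ^+ 3.
  rewrite -subr_ge0 (_ : s ^+ 3 - q = (s - 1) ^+ 2 * (s + 2)).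
    by rewrite mulr_ge0 ?sqr_ge0// addr_ge0// ltW.
  by rewrite /s; field.
have h (n : nat) : n%:R * s ^+ n * (1 - s) <= 1 - s ^+ n.
  elim: n => [|n IH]; first by rewrite !mul0r expr0 subrr.
  rewrite exprS -natr1; have := exprn_gt0 n s0.
  have : s ^+ n <= 1 by rewrite exprn_ile1// ltW.
  move: (s ^+ n) IH => S IH S1 S0.
  have h1 := ler_wpM2l (ltW s0) IH.
  have h2 : s * S * (1 - s) <= 1 - s.
    by rewrite ler_piMl ?subr_ge0 ?(ltW s1)// mulr_ile1// ltW.
  have -> : (n%:R + 1) * (s * S) * (1 - s) =
    s * (n%:R * S * (1 - s)) + s * S * (1 - s) by ring.
  rewrite (le_trans (lerD h1 (lexx _)))//; nra.
pose B := ((1 - s)^-1 + 1) ^+ 2.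
have hB (n : nat) : n.+1%:R ^+ 2 * (s ^+ n * s ^+ n) <= B.
  have s10 : 0 < 1 - s by rewrite subr_gt0.
  have sn0 : 0 < s ^+ n by rewrite exprn_gt0.
  have sn1 : s ^+ n <= 1 by rewrite exprn_ile1// ltW.
  have h1 : n%:R * s ^+ n <= (1 - s)^-1.
    rewrite -[leRHS]mul1r ler_pdivlMr// (le_trans (h n))//; lra.
  have -> : n.+1%:R ^+ 2 * (s ^+ n * s ^+ n) = (n%:R * s ^+ n + s ^+ n) ^+ 2.
    by rewrite -natr1; ring.
  rewrite /B lerXn2r ?nnegrE ?addr_ge0 ?mulr_ge0 ?invr_ge0 ?(ltW sn0) ?(ltW s10)//.
  by rewrite lerD.
apply/ler_addgt0Pr => e e0; rewrite add0r.
have [||n ne] := @geometric_small R s (A * B) e; [by rewrite (ltW s0)|by []|].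
rewrite (le_trans (H n))// (le_trans _ ne)//.
have qs : q ^+ n <= s ^+ n * (s ^+ n * s ^+ n).
  by rewrite -!exprD addnn -mul2n -mulSn exprM lerXn2r ?nnegrE// exprn_ge0// ltW.
have sn0 : 0 <= s ^+ n by rewrite exprn_ge0// ltW.
rewrite -(mulrA A) (mulrCA _ A) ler_wpM2l//.
apply: (@le_trans _ _ (n.+1%:R ^+ 2 * (s ^+ n * (s ^+ n * s ^+ n)))).
  by rewrite ler_wpM2l// exprn_ge0.
by rewrite mulrCA ler_wpM2l.
Qed.

(* [f] is the sum of a power series with bounded coefficients; only the
   estimates on its Taylor polynomials are used. *)
Lemma quadratic_identity (f : R -> R) (b : nat -> R) (B : R) (D : R -> R) (X1 e1 : R) :
  0 <= B -> (forall k, `|b k| <= B) -> (forall x, -1 <= x -> x < 0 -> D x <= B) ->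
  (forall x (k : nat), -1 <= x < 1 ->
     `|f x - (\poly_(i < k) b i).[x]| <= D x * `|x| ^+ k) ->
  (forall x, -1 <= x -> x <= 0 -> f x ^+ 2 / 2 - (X1 - e1 * x) * f x + 1 = 0) ->
  forall x, 0 <= x -> x < 1 -> f x ^+ 2 / 2 - (X1 - e1 * x) * f x + 1 = 0.
Proof.
move=> B0 bB DB fP E0 x x0 x1.
pose P k : {poly R} := \poly_(i < k) b i.
(* The quadratic expression with [f] replaced by its Taylor polynomial [P k]. *)
pose Q k : {poly R} := 2^-1 *: (P k * P k) - (X1%:P - e1 *: 'X) * P k + 1.
pose E y := f y ^+ 2 / 2 - (X1 - e1 * y) * f y + 1.
pose L := `|X1| + `|e1|.
have L0 : 0 <= L by rewrite addr_ge0.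
have QE k y : (Q k).[y] = (P k).[y] ^+ 2 / 2 - (X1 - e1 * y) * (P k).[y] + 1.
  rewrite /Q hornerD hornerD hornerN hornerZ 2!hornerM hornerD hornerN hornerZ.
  by rewrite !hornerC hornerX; field.
have EQ k y : `|y| <= 1 -> 0 <= D y -> `|f y - (P k).[y]| <= D y * `|y| ^+ k ->
    `|E y - (Q k).[y]| <= (`|f y| + D y + L) * (D y * `|y| ^+ k).
  move=> y1 D0 h; rewrite QE.
  set p := (P k).[y] in h *; set d := D y * _ in h *.
  have d0 : 0 <= d by rewrite mulr_ge0// exprn_ge0.
  have dD : d <= D y by rewrite ler_piMr// exprn_ile1.
  have -> : E y - (p ^+ 2 / 2 - (X1 - e1 * y) * p + 1) =
    (f y - p) * ((f y + f y - (f y - p)) / 2 - (X1 - e1 * y)).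
    by rewrite /E; field.
  rewrite normrM mulrC ler_pM// (le_trans (ler_normB _ _))// lerD//.
    rewrite normrM (ger0_norm (x := 2^-1)) ?invr_ge0// ler_pdivrMr//.
    rewrite (le_trans (ler_normB _ _))//.
    have := ler_normD (f y) (f y); have := le_trans h dD.
    by have := normr_ge0 (f y); lra.
  rewrite (le_trans (ler_normB _ _))// lerD// normrM ler_piMr//.
have D_ge0 y : -1 <= y < 1 -> y != 0 -> 0 <= D y.
  move=> y1 y0; have := le_trans (normr_ge0 _) (fP y 1%N y1).
  by rewrite expr1 pmulr_lge0// normr_gt0.
have Dle y : -1 <= y -> y < 0 -> 0 <= D y <= B.
  move=> y1 y0; rewrite DB// D_ge0 ?y1 ?lt_eqF//.
  by rewrite (lt_trans y0).
have fB y : -1 <= y -> y < 0 -> `|f y| <= B.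
  move=> y1 y0; have y11 : -1 <= y < 1 by rewrite y1 (lt_trans y0).
  have := fP y 0%N y11; rewrite poly_def big_ord0 horner0 subr0 expr0 mulr1.
  by move=> /le_trans; apply; case/andP: (Dle _ y1 y0).
(* For negative arguments the exact expression is 0, so [Q k] is of order [|y| ^+ k] there and its
   low coefficients vanish; this carries the identity across 0. *)
have Q0 k j : (j < k)%N -> (Q k)`_j = 0.
  apply: (@coef_eq0_of_small _ _ ((B + B + L) * B)) => y y1 y0.
  have y11 : -1 <= y < 1 by rewrite y1 (lt_trans y0).
  have ny : `|y| <= 1 by rewrite ltr0_norm// lerNl.
  have /andP[Dy0 DyB] := Dle _ y1 y0.
  have := EQ k y ny Dy0 (fP _ _ y11).
  rewrite /E E0// ?(ltW y0)// sub0r normrN => /le_trans; apply.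
  rewrite -mulrA ler_pM ?addr_ge0 ?mulr_ge0 ?exprn_ge0//.
    by rewrite lerD2r lerD// fB.
  by rewrite ler_wpM2r ?exprn_ge0.
have Pb k j : `|(P k)`_j| <= B.
  by rewrite coef_poly; case: ifP => _; rewrite ?normr0.
have sP k : (size (P k) <= k)%N by exact: size_poly.
have sPP k : (size (P k * P k)%R <= (2 * k).+1)%N.
  rewrite (leq_trans (size_polyMleq _ _))// mul2n -addnn.
  by rewrite (leq_trans (leq_pred _))// (leq_trans (leq_add (sP k) (sP k))).
have sX k : (size ((X1%:P - e1 *: 'X) * P k)%R <= (2 * k).+1)%N.
  have [->|k0] := posnP k; first by rewrite /P poly_def big_ord0 mulr0 size_poly0.
  rewrite (leq_trans (size_polyMleq _ _))//.
  have h : (size (X1%:P - e1 *: 'X)%R <= 2)%N.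
    rewrite (leq_trans (size_polyD _ _))// geq_max size_polyN.
    by rewrite (leq_trans (size_polyC_leq1 _))//= (leq_trans (size_scale_leq _ _))// size_polyX.
  rewrite (@leq_trans (2 + k).-1)//.
    by rewrite -!subn1 leq_sub2r// leq_add.
  by rewrite ltnS mul2n -addnn leq_addr.
have sQ k : (size (Q k) <= (2 * k).+1)%N.
  rewrite (leq_trans (size_polyD _ _))// geq_max size_poly1 /= andbT.
  rewrite (leq_trans (size_polyD _ _))// geq_max size_polyN sX andbT.
  by rewrite (leq_trans (size_scale_leq _ _)).
pose A := B ^+ 2 + L * B + 1.
have A0 : 0 <= A by rewrite !addr_ge0// ?exprn_ge0// mulr_ge0.
have PPb k j : `|(P k * P k)`_j| <= (2 * k).+1%:R * B ^+ 2.
  have [jk|kj] := ltnP j (2 * k).+1; last first.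
    by rewrite nth_default ?normr0 ?mulr_ge0 ?exprn_ge0// (leq_trans (sPP k)).
  rewrite coefM (le_trans (ler_norm_sum _ _ _))//.
  apply: (@le_trans _ _ (\sum_(i < j.+1) B ^+ 2)).
    by apply: ler_sum => i _; rewrite normrM expr2 ler_pM.
  by rewrite sumr_const card_ord -[leLHS]mulr_natl ler_wpM2r ?exprn_ge0// ler_nat.
have Qb k j : `|(Q k)`_j| <= (2 * k).+1%:R * A.
  have n1 : 1 <= (2 * k).+1%:R :> R by rewrite ler1n.
  rewrite coefD coefB coefZ coef1 mulrBl coefB coefCM -scalerAl coefZ coefXM.
  have h1 : `|2^-1 * (P k * P k)`_j| <= (2 * k).+1%:R * B ^+ 2.
    rewrite normrM ger0_norm ?invr_ge0// (le_trans _ (PPb k j))// ler_piMl//; lra.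
  have h2 : `|X1 * (P k)`_j - e1 * (if j == 0%N then 0 else (P k)`_j.-1)| <= L * B.
    rewrite (le_trans (ler_normB _ _))// mulrDl lerD// normrM ler_wpM2l//.
    by case: ifP => _; rewrite ?normr0.
  have h3 : `|((j == 0%N)%:R : R)| <= 1 by case: (_ == _); rewrite ?normr1 ?normr0.
  rewrite (le_trans (ler_normD _ _))// (le_trans (lerD (ler_normB _ _) (lexx _)))//.
  have LB : 0 <= L * B by rewrite mulr_ge0.
  have := lerD (lerD h1 h2) h3; rewrite /A; nra.
have [->|xn0] := eqVneq x 0; first by apply: E0.
have x11 : -1 <= x < 1 by rewrite x1 andbT (le_trans _ x0)// oppr_le0.
have Dx := D_ge0 _ x11 xn0.
have nx : `|x| <= 1 by rewrite ger0_norm// ltW.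
apply/eqP; rewrite -/(E x) -normr_le0.
(* The first summand bounds the error of replacing [f] by its Taylor polynomial, the second bounds
   [Q n] at [x], using [(2n + 1) ^+ 2 <= 4 (n + 1) ^+ 2]. *)
pose A' := (`|f x| + D x + L) * D x + 4 * A.
apply: (@square_geometric_le0 _ A' `|x|) => //.
- by rewrite ger0_norm.
- by rewrite addr_ge0 ?mulr_ge0// ?addr_ge0.
move=> n; have -> : E x = (E x - (Q n).[x]) + (Q n).[x] by ring.
rewrite (le_trans (ler_normD _ _))// /A' mulrDl mulrDl lerD//.
  rewrite (le_trans (EQ n x nx Dx (fP _ _ x11)))// mulrA ler_wpM2r ?exprn_ge0//.
  by rewrite ler_peMr ?mulr_ge0 ?addr_ge0// exprn_ege1// ler1n.
have := @horner_bound_of_coef (Q n) n (2 * n).+1 ((2 * n).+1%:R * A) x.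
move=> /(_ _ nx (sQ n) (Q0 n) (Qb n)) H; rewrite (le_trans (H _))//.
  by rewrite mulr_ge0.
set m := (2 * n).+1%:R; set N := n.+1%:R ^+ 2.
have mN : m * m <= 4 * N.
  rewrite -expr2 (_ : 4 * N = (2 * n.+1%:R) ^+ 2); last by rewrite /N; ring.
  by rewrite lerXn2r ?nnegrE// -natrM ler_nat mulnS addnC addn2 ltnS leqnSn.
have -> : m * (m * A) = m * m * A by ring.
have -> : 4 * A * N = 4 * N * A by ring.
by rewrite !ler_wpM2r// exprn_ge0.
Qed.

End PowerSeriesIdentity.

Section HalfPower.
Variable R : realType.
Local Notation C := R[i].
Local Notation Re := (@complex.Re R).
Local Notation Im := (@complex.Im R).
Variable nu : borel_prob R.
Implicit Types (x y eta theta : R).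

Let ker x (t : R) : C := (0 +i* x - t%:C)^-1.

(** The resolvent identity between heights [eta] and [eta * (1 - theta)]; iterating it produces the
    Taylor expansion in [theta] with exact remainder. *)
Let ker_split eta theta (t : R) : 0 < eta -> theta < 1 ->
  ker (eta * (1 - theta)) t =
  ker eta t + theta%:C * (0 +i* eta * ker eta t * ker (eta * (1 - theta)) t).
Proof.
move=> e0 th1; have x0 : 0 < eta * (1 - theta) by rewrite mulr_gt0// subr_gt0.
have d1 : 0 +i* eta - t%:C != 0 by apply: Im_gt0_neq0; rewrite !cReImE /= subr0.
have d2 : 0 +i* (eta * (1 - theta)) - t%:C != 0.
  by apply: Im_gt0_neq0; rewrite !cReImE /= subr0.
have dE : 0 +i* (eta * (1 - theta)) - t%:C =
    0 +i* eta - t%:C - theta%:C * (0 +i* eta).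
  by apply: complex_eqP; rewrite !cReImE /=; ring.
have gen (a b th ie : C) : a != 0 -> b != 0 -> b = a - th * ie ->
    b^-1 = a^-1 + th * (ie * a^-1 * b^-1).
  by move=> a0 b0 bE; move: b0; rewrite bE => b0; field; rewrite a0 b0.
exact: gen dE.
Qed.

Let cmeasurable (h : R -> C) := measurable_fun setT (fun t => Re (h t)) /\
  measurable_fun setT (fun t => Im (h t)).

Let cmeasurableM h1 h2 : cmeasurable h1 -> cmeasurable h2 ->
  cmeasurable (fun t => h1 t * h2 t).
Proof.
move=> [r1 i1] [r2 i2]; split.
  rewrite (_ : (fun _ => _) = (fun t => Re (h1 t) * Re (h2 t) - Im (h1 t) * Im (h2 t))).
    by apply: measurable_funB; apply: measurable_funM.
  by apply/funext => t; rewrite !cReImE.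
rewrite (_ : (fun _ => _) = (fun t => Re (h1 t) * Im (h2 t) + Im (h1 t) * Re (h2 t))).
  by apply: measurable_funD; apply: measurable_funM.
by apply/funext => t; rewrite !cReImE.
Qed.

(** With [x = eta] this is the kernel of the k-th Taylor coefficient, with [x = eta * (1 - theta)]
    that of the remainder. The base of the power has modulus at most 1. *)
Let ker_pow eta x k (t : R) : C := (0 +i* eta * ker eta t) ^+ k * ker x t.

Let measurable_ker_pow eta x k : 0 < eta -> 0 < x -> cmeasurable (ker_pow eta x k).
Proof.
move=> e0 x0; have K y : 0 < y -> cmeasurable (ker y).
  by move=> y0; split; [exact: measurable_Re_cauchy_kernel|
                        exact: measurable_Im_cauchy_kernel].
rewrite /ker_pow; apply: cmeasurableM; last exact: K.
elim: k => [|k IH]; first by split; exact: measurable_cst.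
rewrite (_ : (fun _ => _) =
    (fun t => 0 +i* eta * ker eta t * (0 +i* eta * ker eta t) ^+ k)).
  apply: cmeasurableM IH; apply: cmeasurableM; last exact: K.
  by split; exact: measurable_cst.
by apply/funext => t; rewrite exprS.
Qed.

Let ker_pow_bound eta x k t : 0 < eta -> 0 < x ->
  `|- Im (ker_pow eta x k t)| <= x^-1.
Proof.
move=> e0 x0; rewrite normrN (le_trans (Im_le_normc _))// /ker_pow normcM normcX.
have h : normc (ker x t) <= x^-1 by exact: normc_cauchy_kernel.
apply: le_trans h; rewrite ler_piMl ?normc_ge0//.
rewrite exprn_ile1 ?normc_ge0// normcM normc_imag gtr0_norm//.
rewrite -[leRHS](mulfV (lt0r_neq0 e0)) ler_pM2l//.
exact: normc_cauchy_kernel.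
Qed.

Let integrable_ker_pow eta x k : 0 < eta -> 0 < x ->
  nu.-integrable setT (EFin \o (fun t => - Im (ker_pow eta x k t))).
Proof.
move=> e0 x0; apply: (@bounded_integrable_prob _ _ _ x^-1).
  by apply: measurableT_comp => //; have [_ ] := measurable_ker_pow k e0 x0.
by move=> t; exact: ker_pow_bound.
Qed.

Let moment eta x k := \int[nu]_t (- Im (ker_pow eta x k t)).

Let moment_bound eta x k : 0 < eta -> 0 < x -> `|moment eta x k| <= x^-1.
Proof.
move=> e0 x0; rewrite (le_trans (le_normr_Rintegral _ (integrable_ker_pow k e0 x0)))//.
rewrite -[leRHS](Rintegral_prob_cst nu); apply: (@Rintegral_prob_le _ _ _ _ x^-1 x^-1).
- do 2 apply: measurableT_comp => //; by have [_ ] := measurable_ker_pow k e0 x0.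
- exact: measurable_cst.
- by move=> t; rewrite normr_id; exact: ker_pow_bound.
- by move=> t; rewrite ger0_norm ?invr_ge0// ltW.
- by move=> t; exact: ker_pow_bound.
Qed.

Let moment_split eta theta k : 0 < eta -> theta < 1 ->
  moment eta (eta * (1 - theta)) k =
  moment eta eta k + theta * moment eta (eta * (1 - theta)) k.+1.
Proof.
move=> e0 th1; have x0 : 0 < eta * (1 - theta) by rewrite mulr_gt0// subr_gt0.
rewrite /moment -RintegralZl//; last exact: integrable_ker_pow.
rewrite -RintegralD//; [|exact: integrable_ker_pow|]; last first.
  have := integrableZl measurableT theta (integrable_ker_pow k.+1 e0 x0).
  exact.
apply: eq_Rintegral => t _; rewrite /ker_pow {1}ker_split// exprSr.
set X := (0 +i* eta * ker eta t); set Z := ker (eta * _) t.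
have -> : X ^+ k * (ker eta t + theta%:C * (X * Z)) =
  X ^+ k * ker eta t + theta%:C * (X ^+ k * X * Z) by ring.
by rewrite !(cImD, cImM theta%:C) /= mul0r addr0 opprD mulrN.
Qed.

Let moment_taylor eta theta k : 0 < eta -> theta < 1 ->
  moment eta (eta * (1 - theta)) 0 =
  (\poly_(i < k) moment eta eta i).[theta] +
  theta ^+ k * moment eta (eta * (1 - theta)) k.
Proof.
move=> e0 th1; rewrite horner_poly; elim: k => [|k ->].
  by rewrite big_ord0 add0r expr0 mul1r.
by rewrite big_ord_recr /= moment_split// exprSr; ring.
Qed.

Let transformE x : 0 < x -> - Im (cauchy_transform nu (0 +i* x)) = moment x x 0.
Proof.
move=> x0; rewrite Im_cauchy_transform// opprK; apply: eq_Rintegral => t _.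
by rewrite /ker_pow expr0 mul1r Im_cauchy_kernel// opprK.
Qed.

Let moment0 eta x : moment eta x 0 = moment x x 0.
Proof. by apply: eq_Rintegral => t _; rewrite /ker_pow !expr0. Qed.

(** One expansion at [eta] in [theta = 1 - x / eta] suffices: [theta] in [[-1, 0]] covers
    [[eta, 2 eta]], where the equation is assumed, and [theta] in [[0, 1[] covers all of []0,
    eta]]. *)
Lemma quadratic_cauchy_transform (c eta : R) : 0 < eta ->
  let f x := - Im (cauchy_transform nu (0 +i* x)) in
  (forall x, eta <= x -> f x ^+ 2 / 2 - (x + c) * f x + 1 = 0) ->
  forall x, 0 < x -> x <= eta -> f x ^+ 2 / 2 - (x + c) * f x + 1 = 0.
Proof.
move=> e0 f H x x0 xe.
pose h theta := f (eta * (1 - theta)).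
have hE theta : theta < 1 -> h theta = moment eta (eta * (1 - theta)) 0.
  by move=> t1; rewrite /h /f transformE ?moment0// mulr_gt0// subr_gt0.
have hq theta : h theta ^+ 2 / 2 - (eta + c - eta * theta) * h theta + 1 =
  f (eta * (1 - theta)) ^+ 2 / 2 -
    (eta * (1 - theta) + c) * f (eta * (1 - theta)) + 1 by rewrite /h; ring.
have xE : x = eta * (1 - (1 - x / eta)) by field; rewrite gt_eqF.
rewrite xE -hq.
apply: (@quadratic_identity _ h (moment eta eta) eta^-1
  (fun theta => (eta * (1 - theta))^-1)).
- by rewrite invr_ge0 ltW.
- by move=> k; exact: moment_bound.
- move=> theta _ t0; rewrite lef_pV2 ?posrE// ?mulr_gt0//; last by lra.
  by rewrite ler_peMr ?ltW//; lra.
- move=> theta k /andP[_ t1]; rewrite hE// (moment_taylor k)// addrC addKr.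
  rewrite normrM normrX mulrC ler_wpM2r ?exprn_ge0// moment_bound//.
  by rewrite mulr_gt0// subr_gt0.
- move=> theta _ t0; rewrite hq; apply: H.
  by rewrite ler_peMr ?(ltW e0)//; lra.
- by rewrite subr_ge0 ler_pdivrMr// mul1r.
- by rewrite gtrBl divr_gt0.
Qed.

End HalfPower.

Section NotInfinitelyDivisible.
Variable R : realType.
Local Notation C := R[i].
Local Notation Re := (@complex.Re R).
Local Notation Im := (@complex.Im R).

(** Uniqueness forces the transform of [nu] to be half that of [mu] high on the imaginary axis, so
    [F_nu] maps [i (y - 5/4 + 1 / (2y))] to [iy]; the equation is this relation for [f = 1 / y]. *)
Lemma half_power_quadratic (nu mu : borel_prob R) F :
  law_of 1 (neginv 1) F mu -> is_free_power nu 2 mu ->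
  exists Y : R, forall x, Y <= x -> let f := - Im (cauchy_transform nu (0 +i* x)) in
    f ^+ 2 / 2 - (x + 5 / 4) * f + 1 = 0.
Proof.
move=> muF P2; inversion P2 as [|n nu' rho P1 FC]; subst.
(* The successor constructor cannot produce power 1, since no law is a free power of order 0. *)
have nuE : nu' = nu by inversion P1 as [|n' nu'' rho' P0] => //; inversion P0.
have [a [b [phi [psi [a0 b0 V1 V2 V3]]]]] := FC; rewrite {}nuE in V1.
have V4 := law_of_voiculescu ltr01 (neginv_bound (lexx 1)) (neginv_lip (lexx 1)) muF (lexx _).
have [Y1 H1] := voiculescu_transform_unique a0 a0 V1 V2.
have [Y2 H2] := voiculescu_transform_unique a0 ltr01 V3 V4.
have [a' [b' [a'0 b'0 _ V]]] := V1.
pose Y := Num.max 1 (Num.max b (Num.max Y1 Y2)).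
have Y_ge1 : 1 <= Y by rewrite le_max lexx.
exists (2 * Y + 1) => x Yx; pose X := x + 5 / 4; pose s := Num.sqrt (X ^+ 2 - 2).
have X2 : 0 <= X ^+ 2 - 2 by rewrite /X; nra.
have s2 : s ^+ 2 = X ^+ 2 - 2 by rewrite sqr_sqrtr.
have s0 : 0 <= s := sqrtr_ge0 _.
(* The larger root of [y ^+ 2 - X y + 1/2 = 0]; being at least [X / 2], it exceeds [Y]. *)
pose y := (X + s) / 2.
have yY : Y < y by rewrite /y /X; lra.
have y0 : 0 < y by rewrite (lt_trans _ yY)// (lt_le_trans ltr01).
have yE : x = y - 5 / 4 + (2 * y)^-1.
  have : y ^+ 2 - X * y + 2^-1 = 0.
    rewrite /y (_ : _ + _ = (s ^+ 2 - X ^+ 2 + 2) / 4); last by field.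
    by rewrite s2; field.
  rewrite /X => h; apply/eqP; rewrite -subr_eq0.
  rewrite (_ : _ - _ = - (y ^+ 2 - (x + 5 / 4) * y + 2^-1) / y).
    by rewrite h oppr0 mul0r.
  by field; rewrite gt_eqF.
move: (yY); rewrite /Y !gt_max => /and4P[_ yb yY1 yY2].
have [|_ Fnu] := V (0 +i* y).
  by split => //=; rewrite normr0 mulr_gt0.
have iy0 : 0 +i* y != 0 :> C by exact: Im_gt0_neq0.
have phiE : phi (0 +i* y) = 0 +i* ((2 * y)^-1 - 5 / 4).
  have := H2 _ yY2; rewrite -(H1 _ yY1) /neginv.
  have -> : 1%:C / (0 +i* y) = 0 +i* (- y^-1).
    apply: (mulIf iy0); rewrite mulfVK//.
    by apply: complex_eqP; rewrite !cReImE /=; field; rewrite gt_eqF.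
  move=> /eqP; rewrite eq_complex !cReImE /= => /andP[/eqP r /eqP i].
  by apply: complex_eqP => /=; [lra|rewrite invfM; lra].
have : cauchy_transform nu (0 +i* x) = 0 +i* (- y^-1).
  have -> : 0 +i* x = 0 +i* y + phi (0 +i* y).
    by rewrite phiE; apply: complex_eqP; rewrite !cReImE /= ?addr0// yE; ring.
  rewrite -[LHS]invrK -/(recip_cauchy nu _) Fnu.
  by apply: (mulIf iy0); rewrite mulVf//; apply: complex_eqP;
    rewrite !cReImE /=; field; rewrite gt_eqF.
move=> -> /=; rewrite opprK yE; field; by rewrite gt_eqF.
Qed.

Lemma not_free_infinitely_divisible_neginv1 (mu : borel_prob R) F :
  law_of 1 (neginv 1) F mu -> ~ free_infinitely_divisible mu.
Proof.
move=> muF /(_ 2%N isT)[nu /(half_power_quadratic muF)[Y HY]].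
pose eta := Num.max 1 Y; have e1 : 1 <= eta by rewrite le_max lexx.
have e0 : 0 < eta by rewrite (lt_le_trans ltr01).
have := @quadratic_cauchy_transform _ nu (5 / 4) eta e0.
move=> /(_ _ 10^-1); rewrite invr_gt0 ltr0n => H.
have : 10^-1 <= eta :> R by lra.
move/H => /(_ _ isT); set f := - _ => h.
have : f ^+ 2 / 2 - (10^-1 + 5 / 4) * f + 1 = 0.
  by apply: h => x ex; apply: HY; rewrite (le_trans _ ex)// le_max lexx orbT.
(* Completing the square leaves [2 - (27/20) ^+ 2 > 0]. *)
have := sqr_ge0 (f - (10^-1 + 5 / 4)); nra.
Qed.

End NotInfinitelyDivisible.

(** * Distance to the infinitely divisible class and the final rate *)

Section Distance.
Variable R : realType.

(** Should the set have no supremum, [sup] takes the default value 0, so no boundedness has to be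
    proved. *)
Lemma kolmogorov_dist_ge0 (mu nu : borel_prob R) : 0 <= kolmogorov_dist mu nu.
Proof.
rewrite /kolmogorov_dist; set A := [set _ | _ in _].
have [A_sup|/sup_out->//] := pselect (has_sup A).
have [z Az] := A_sup.1; apply: le_trans (ub_le_sup A_sup.2 Az).
by have [x _ <-] := Az; exact: normr_ge0.
Qed.

Lemma kolmogorov_dist_set_le (mu nu : borel_prob R) (D : set (borel_prob R)) :
  D nu -> kolmogorov_dist_set mu D <= kolmogorov_dist mu nu.
Proof.
move=> Dnu; apply: ge_inf; last by exists nu.
by exists 0 => _ [rho _ <-]; exact: kolmogorov_dist_ge0.
Qed.

Lemma kolmogorov_rate_le (n : nat) (l : R) : (0 < n)%N -> 1 <= l ->
  4 / 3 * 2^-1 ^+ n <= expR (- (ln (3 / 2) * Num.sqrt n%:R / l)).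
Proof.
move=> n0 l1; have l0 : 0 < l by rewrite (lt_le_trans ltr01).
have c0 : 0 < ln (3 / 2 : R) by rewrite ln_gt0//; lra.
apply: (@le_trans _ _ ((2 / 3) ^+ n)).
  (* Equality holds at [n = 1]; this is how [2/3] absorbs the factor [4/3]. *)
  case: n n0 => // n _; elim: n => [|n IH]; first by rewrite !expr1; lra.
  by rewrite exprS [leRHS]exprS mulrCA; apply: ler_pM => //; lra.
have -> : (2 / 3) ^+ n = expR (- (ln (3 / 2) * n%:R)) :> R.
  rewrite (_ : - _ = n%:R * - ln (3 / 2)); last by ring.
  rewrite expRM_natl expRN lnK ?posrE; last by lra.
  by congr (_ ^+ _); field.
rewrite ler_expR lerN2 -mulrA ler_pM2l// ler_pdivrMr//.
apply: (@le_trans _ _ n%:R); last by rewrite ler_peMr.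
have n1 : 1 <= n%:R :> R by rewrite ler1n.
rewrite -[leRHS]ger0_norm// -sqrtr_sqr ler_wsqrtr// expr2 ler_peMr//.
Qed.

End Distance.

Theorem theorem2p9 (R : realType) (L : R -> R)
  (L_ge1 : forall x : R, 0 <= x -> 1 <= L x)
  (L_sv : slowly_varying L)
  (L_C1 : continuously_differentiable_ge0 L)
  (L_equiv : asymp_equiv L (fun x => L (x / L x)))
  (L_sum : (\sum_(1 <= n <oo) ((n%:R * L n%:R)^-1)%:E < +oo)%E) :
  exists mu : borel_prob R,
    [/\ symmetric_prob mu,
        ~ free_infinitely_divisible mu &
        exists c4 : R, 0 < c4 /\
          forall n : nat, (0 < n)%N ->
            exists2 mu_n : borel_prob R,
              is_free_power mu n mu_n &
              kolmogorov_dist_set mu_n (@free_infinitely_divisible R)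
                <= expR (- (c4 * Num.sqrt n%:R / L n%:R))].
Proof.
have [m [mP mpow]] := is_free_power_neginv R.
have [F0 m0] := mP 0%N; exists (m 0%N); split.
- by case: m0.
- exact: not_free_infinitely_divisible_neginv1 m0.
exists (ln (3 / 2)); split; first by rewrite ln_gt0//; lra.
case=> // n _; exists (m n); first exact: mpow.
have [F mF] := mP n.
(* [m n] is the power [n + 1], so the comparison law is truncated at order [n + 1]. *)
have [F' [nu [nuF nuID]]] := free_infinitely_divisible_neginv_trunc R (ltn0Sn n).
rewrite (le_trans (kolmogorov_dist_set_le _ nuID))//.
rewrite (le_trans (kolmogorov_dist_neginv_neginv_trunc _ mF nuF))//.
by apply: kolmogorov_rate_le => //; exact: L_ge1.
Qed.
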